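(* Let $s\in(0,1)$. Then there exists $\theta=\theta(n,s)>1$ such that if $G$ is an N-function satisfying the $\Delta_2$ condition and the $\nabla_2$ condition with constants $\kappa$ and $l$, respectively, $B_r\subset\mathbb{R}^n$ is a ball of radius $r>0$, and $f\in W^{s,G}(B_r)$, then $$\left(\frac{1}{|B_r|}\int_{B_r}G\left(\frac{|f-(f)_{B_r}|}{r^s}\right)^{\theta}dx\right)^{\frac{1}{\theta}} \le c\, \frac{1}{|B_r|}\int_{B_r}\int_{B_r} G\left(\frac{|f(x)-f(y)|}{|x-y|^s}\right)\frac{dy\, dx}{|x-y|^n},$$ where $c>0$ depends only on $n,s,\kappa,l$.
   Context: $n\ge2$ and $(f)_{B_r}:=\frac{1}{|B_r|}\int_{B_r}f\,dx$. A function $G:[0,\infty)\to[0,\infty)$ is an N-function if it is increasing and convex, $G(0)=0$, $\lim_{t\to0+}G(t)/t=0$ and $\lim_{t\to\infty}G(t)/t=\infty$. $\Delta_2$ condition with constant $\kappa>1$: $G(2t)\le\kappa G(t)$ for all $t\ge0$. $\nabla_2$ condition with constant $l>1$: $G(t)\le\frac{1}{2l}G(lt)$ for all $t\ge0$. For an open set $U\subset\mathbb{R}^n$, $W^{s,G}(U)$ is the set of real-valued measurable functions $v$ on $U$ with $\int_UG(|v|)\,dx<\infty$ and $\int_U\int_UG\left(\frac{|v(x)-v(y)|}{|x-y|^s}\right)\frac{dx\,dy}{|x-y|^n}<\infty$. *)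

(* Defs.v *)
From HB Require Import structures.
From mathcomp Require Import all_boot all_order all_algebra.
From mathcomp Require Import all_classical all_reals all_analysis.
From mathcomp Require Import measurable_realfun.

Set Implicit Arguments.
Unset Strict Implicit.
Unset Printing Implicit Defensive.

Import Order.TTheory GRing.Theory Num.Theory.
Import numFieldNormedType.Exports.

Local Open Scope classical_set_scope.
Local Open Scope ring_scope.

(* Points of R^n are [n.-tuple R], with the library's product sigma-algebra,
   i.e. the Borel sets. *)

Section lebesgue_measure_tuple.
Context {R : realType}.
Local Open Scope ereal_scope.

Definition cons_pair n (x : measurableTypeR R * n.-tuple R) : n.+1.-tuple R :=
  [tuple of x.1 :: x.2].

Definition uncons_pair n (x : n.+1.-tuple R) : measurableTypeR R * n.-tuple R :=
  (thead x, [tuple of behead x]).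

Lemma cons_pairK n : cancel (@cons_pair n) (@uncons_pair n).
Proof. by case=> x t; congr pair; apply: val_inj. Qed.

Lemma measurable_cons_pair n : measurable_fun setT (@cons_pair n).
Proof.
by apply: measurable_cons; [exact: measurable_fst | exact: measurable_snd].
Qed.

Lemma measurable_uncons_pair n : measurable_fun setT (@uncons_pair n).
Proof.
apply/measurable_fun_pairP; split => /=.
  by apply: (eq_measurable_fun (fun x : n.+1.-tuple R => tnth x ord0)) => //;
    exact: measurable_tnth.
exact: measurable_behead.
Qed.

Section step.
Variables (n : nat) (m : {sigma_finite_measure set (n.-tuple R) -> \bar R}).

Definition lebesgue_step : set (n.+1.-tuple R) -> \bar R :=
  pushforward (lebesgue_measure \x m) (@cons_pair n).

Let mcons : measurable_fun setT (@cons_pair n) := @measurable_cons_pair n.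

Let step0 : lebesgue_step set0 = 0.
Proof. by rewrite /lebesgue_step /pushforward preimage_set0 measure0. Qed.

Let step_ge0 A : 0 <= lebesgue_step A.
Proof. exact: measure_ge0. Qed.

Let step_sigma_additive : semi_sigma_additive lebesgue_step.
Proof.
move=> F mF tF mUF; rewrite /lebesgue_step /pushforward preimage_bigcup.
apply: measure_semi_sigma_additive.
- by move=> k; rewrite -[X in measurable X]setTI; exact: mcons.
- apply/trivIsetP => /= i j _ _ ij; rewrite -preimage_setI.
  by move/trivIsetP : tF => /(_ _ _ _ _ ij) ->//; rewrite preimage_set0.
- by rewrite -preimage_bigcup -[X in measurable X]setTI; exact: mcons.
Qed.

HB.instance Definition _ :=
  isMeasure.Build _ _ _ lebesgue_step step0 step_ge0 step_sigma_additive.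

Let step_sigma_finite : sigma_finite setT lebesgue_step.
Proof.
have /sigma_finiteP[F [TF ndF Foo]] := sigma_finiteT (@lebesgue_measure R).
have /sigma_finiteP[G [TG ndG Goo]] := sigma_finiteT m.
exists (fun k => @uncons_pair n @^-1` (F k `*` G k)).
  rewrite -preimage_bigcup; apply/seteqP; split => //= x _.
  have [k _ Fk] : (\bigcup_k F k) (thead x) by rewrite -TF.
  have [l _ Gl] : (\bigcup_k G k) [tuple of behead x] by rewrite -TG.
  exists (maxn k l) => //; split=> /=.
    by move: Fk; exact/subsetPset/ndF/leq_maxl.
  by move: Gl; exact/subsetPset/ndG/leq_maxr.
move=> k; have [mF Fk] := Foo k; have [mG Gk] := Goo k; split.
  rewrite -[X in measurable X]setTI; apply: measurable_uncons_pair => //.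
  exact: measurableX.
rewrite /lebesgue_step /pushforward -comp_preimage.
rewrite [X in X @^-1` _](_ : _ = id); last first.
  by apply/funext => x; exact: cons_pairK.
by rewrite preimage_id product_measure1E// lte_mul_pinfty// ge0_fin_numE.
Qed.

HB.instance Definition _ :=
  Measure_isSigmaFinite.Build _ _ _ lebesgue_step step_sigma_finite.

Lemma lebesgue_step_box (A : set R) (B : set (n.-tuple R)) :
  measurable A -> measurable B ->
  lebesgue_step (@uncons_pair n @^-1` (A `*` B)) = lebesgue_measure A * m B.
Proof.
move=> mA mB; rewrite -product_measure1E// /lebesgue_step /pushforward.
rewrite -comp_preimage [X in X @^-1` _](_ : _ = id) ?preimage_id//.
by apply/funext => x; exact: cons_pairK.
Qed.

End step.

Fixpoint lebesgue_tuple n : {sigma_finite_measure set (n.-tuple R) -> \bar R} :=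
  match n with
  | 0 => \d_([tuple] : 0.-tuple R)
  | n.+1 => lebesgue_step (lebesgue_tuple n)
  end.

(* On boxes the measure is the product of the lengths of the sides; this
   characterizes the n-dimensional Lebesgue measure on the Borel sets. *)
Lemma lebesgue_tuple_box n (A : 'I_n -> set R) :
  (forall i, measurable (A i)) ->
  lebesgue_tuple n [set x | forall i, A i (tnth x i)] =
  \prod_(i < n) lebesgue_measure (A i).
Proof.
elim: n A => [|n IH] A mA.
  by rewrite big_ord0 /= diracE mem_set // => -[].
rewrite big_ord_recl -IH//.
set B := [set x : n.-tuple R | forall i, A (lift ord0 i) (tnth x i)].
have mB : measurable B.
  have -> : B = \bigcap_(i in [set: 'I_n])
      ((@tnth n R)^~ i @^-1` A (lift ord0 i)).
    by apply/seteqP; split => x /= h i; [move=> _|]; exact: h.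
  apply: fin_bigcap_measurable => // i _.
  by rewrite -[X in measurable X]setTI; exact: measurable_tnth.
apply: eq_trans (lebesgue_step_box (lebesgue_tuple n) (mA ord0) mB).
congr (lebesgue_step _ _); apply/seteqP; split=> x /=.
  move=> h; split => [|i /=]; first exact: h.
  by have := h (lift ord0 i); rewrite [in tnth x _](tuple_eta x) tnthS.
case=> h0 h i; case: (unliftP ord0 i) => [j ->|->] //.
by have /= := h j; rewrite [in X in _ -> X](tuple_eta x) tnthS.
Qed.

End lebesgue_measure_tuple.

Section euclidean.
Context {R : realType} {n : nat}.
Implicit Types x y : n.-tuple R.

Definition edist x y : R :=
  Num.sqrt (\sum_(i < n) (tnth x i - tnth y i) ^+ 2).

Definition eball x (r : R) : set (n.-tuple R) := [set y | edist x y < r].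

End euclidean.

Section N_functions.
Context {R : realType}.
(* Functions from [0, +oo[ to itself are represented by total functions
   [G : R -> R] on whose values at negative arguments nothing is assumed. *)
Implicit Types G : R -> R.

Record N_function G : Prop := {
  N_function_ge0 : forall t, 0 <= t -> 0 <= G t ;
  N_function_homo : {in `[0, +oo[ &, {homo G : t u / t <= u}} ;
  N_function_convex : convex_function (`[0%R, +oo[%classic : set R) G ;
  N_function0 : G 0 = 0 ;
  N_function_cvg0 : G t / t @[t --> 0^'+] --> 0 ;
  N_function_cvgy : G t / t @[t --> +oo] --> +oo }.

Definition Delta2 G (kappa : R) := forall t, 0 <= t -> G (2 * t) <= kappa * G t.

Definition Nabla2 G (l : R) :=
  forall t, 0 <= t -> G t <= (2 * l)^-1 * G (l * t).

End N_functions.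

Section orlicz_sobolev.
Context {R : realType} {n : nat}.
Implicit Types (U : set (n.-tuple R)) (f : n.-tuple R -> R).
Local Notation leb := (@lebesgue_tuple R n).

(* Measurability with respect to the completion of the Borel sets.  The integral
   of a nonnegative function being a supremum over simple functions below it,
   integrals of such functions over Borel sets have their usual value. *)
Definition lebesgue_measurable_fun U f :=
  forall Y : set R, measurable Y -> completed_algebra_gen leb (U `&` f @^-1` Y).

Local Open Scope ereal_scope.

Definition mean_integral U (F : n.-tuple R -> \bar R) : \bar R :=
  ((fine (leb U))^-1)%:E * \int[leb]_(x in U) F x.

Definition mean U f : R := ((fine (leb U))^-1 * \int[leb]_(x in U) f x)%R.

(* As [0^-1 = 0] in R, the integrand vanishes at [y = x]; a point is a null set
   for n > 0. *)
Definition gagliardo_energy (s : R) (G : R -> R) U f : \bar R :=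
  \int[leb]_(x in U) \int[leb]_(y in U)
    (G (`|f x - f y| / edist x y `^ s) / edist x y ^+ n)%:E.

Definition fractional_orlicz_sobolev (s : R) (G : R -> R) U f :=
  [/\ lebesgue_measurable_fun U f,
      \int[leb]_(x in U) (G `|f x|)%:E < +oo &
      gagliardo_energy s G U f < +oo].

End orlicz_sobolev.

(* Main.v *)
Require Import Defs.
From mathcomp Require Import all_boot all_order all_algebra.
From mathcomp Require Import all_classical all_reals all_analysis.
From mathcomp Require Import measurable_realfun ring lra.

Set Implicit Arguments.
Unset Strict Implicit.
Unset Printing Implicit Defensive.

Import Order.TTheory GRing.Theory Num.Theory.
Import numFieldNormedType.Exports.

Local Open Scope classical_set_scope.
Local Open Scope ring_scope.

(** The proof compares [f x] with the mean of [f] over the ball [B] along a chain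
    of shrinking sets [A_i = B `&` B(x, rho_i)], [rho_i = 2 r / 2 ^ i], with
    [A_0 = B].  Write
    [k x y = G (|f x - f y| / |x - y| ^ s) / |x - y| ^ n] and let [H x] be the
    integral of [k x] over [B], so that the energy [E] is the integral of [H].

    - A ball is fat at every boundary scale, so [|A_i|] is comparable to
      [rho_i ^ n] ([chain_set_ge], [chain_set_le]).

    - Convexity of [G] is used through [G m * u <= m * (G u + G m)]
      ([N_function_young]).  It bounds [G m] times the oscillation of [f]
      on [A_i] linearly by the kernel, and two consecutive means [a_i] and
      [a_(i+1)] of [f] satisfy
      [|a_i - a_(i+1)| * G m <= C * m * rho_i ^ s * (M_i + G m)] for every
      [m >= 0], where [M_i = rho_i ^ -n * \int_(A_i) H] ([chain_step_le]).

    - If [H x] is finite, the same inequality centred at [x] gives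
      [a_i --> f x] ([chain_average_cvg]).

    - Let [q = 2 ^ (- s / 2)], half of the decay of [rho_i ^ s].  Since the steps
      [a_i - a_(i+1)] sum to [mean f - f x], one of them is at least a fixed
      multiple of [q ^ i * |f x - mean f|] ([geometric_pigeonhole]).  For that
      [i] a good choice of [m] in the step estimate yields
      [G (|f x - mean f| / r ^ s) <= c * q ^ i * M_i x]
      ([pointwise_chain_bound]): a single scale controls the oscillation at [x],
      with a geometric gain [q ^ i].

    - [M_i] is bounded by [rho_i ^ -n * E] and, by Tonelli, has integral at most
      [2 ^ n * E].  Hence the integral of [M_i ^ theta] is at most
      [2 ^ n * E * (rho_i ^ -n * E) ^ (theta - 1)], which grows like
      [2 ^ (i * n * (theta - 1))].  With [theta = 1 + s / (4 n)] this consumes only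
      half of the gain [q ^ i], and the sum over all scales is a convergent
      geometric series ([borel_sobolev_poincare]).

    The function [f] is measurable only for the completed sigma-algebra, while
    Tonelli's theorem is about Borel functions; [f] is therefore first replaced by
    a Borel function equal to it off a null set
    ([measurable_fun_representative]). *)

(* The Euclidean distance, not the extended one of a pseudometric space. *)
Local Notation edist := Defs.edist.

(** * N-functions *)

Section N_function_theory.
Context {R : realType}.
Variable G : R -> R.
Hypothesis NG : N_function G.

Lemma N_function_le (t u : R) : 0 <= t -> t <= u -> G t <= G u.
Proof.
move=> t0 tu; apply: (N_function_homo NG) => //; rewrite in_itv/= andbT//.
exact: le_trans tu.
Qed.

Lemma N_function_scale (a t : R) : 0 <= a <= 1 -> 0 <= t -> G (a * t) <= a * G t.
Proof.
move=> /andP[a0 a1] t0.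
have mem u : 0 <= u -> u \in (`[0, +oo[%classic : set R).
  by move=> u0; rewrite inE/= in_itv/= andbT.
have := N_function_convex NG (Itv01 a0 a1) (mem _ t0) (mem _ (lexx 0)).
by rewrite convRE (N_function0 NG) mulr0 addr0 /conv /= scaler0 addr0.
Qed.

(** For [u <= m] the term [m * G m] suffices, and for [u > m] the slope [G t / t]
    of a convex function vanishing at [0] is nondecreasing.  Being linear in [u],
    the left-hand side can be averaged over [u] directly. *)
Lemma N_function_young (m u : R) : 0 <= m -> 0 <= u ->
  G m * u <= m * (G u + G m).
Proof.
move=> m0 u0; have Gu := N_function_ge0 NG u0; have Gm := N_function_ge0 NG m0.
have [um|mu] := leP u m.
  rewrite mulrDr [G m * u]mulrC; apply: (le_trans (ler_wpM2r Gm um)).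
  by rewrite lerDr mulr_ge0.
have up : 0 < u by exact: le_lt_trans mu.
have /(N_function_scale) /(_ u0) : 0 <= m / u <= 1.
  by rewrite divr_ge0//= ler_pdivrMr// mul1r ltW.
rewrite divfK ?gt_eqF// => h.
have : G m * u <= m * G u.
  by rewrite -ler_pdivlMr// mulrAC.
move=> /le_trans; apply; rewrite mulrDr lerDl mulr_ge0//.
Qed.

Lemma Delta2_expn (kappa t : R) (k : nat) : 0 <= kappa -> Delta2 G kappa ->
  0 <= t -> G (2 ^+ k * t) <= kappa ^+ k * G t.
Proof.
move=> kp D2 t0; elim: k => [|k IH]; first by rewrite !expr0 !mul1r.
rewrite !exprS -!mulrA; apply: (le_trans (D2 _ _)).
  by rewrite mulr_ge0// exprn_ge0.
exact: ler_wpM2l.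
Qed.

Lemma N_function_pos : exists2 m : R, 0 < m & 0 < G m.
Proof.
have /cvgryPge /(_ 1) := N_function_cvgy NG.
move=> h; have [m [m0 hm]] : exists m, 0 < m /\ 1 <= G m / m.
  near (pinfty_nbhs R) => m; exists m; split; near: m => //.
  exact: nbhs_pinfty_gt.
exists m => //; rewrite ler_pdivlMr// mul1r in hm; exact: lt_le_trans hm.
Unshelve. all: by end_near. Qed.

Lemma measurable_N_function_norm : measurable_fun setT (fun t : R => G `|t|).
Proof.
(* On negative arguments [G] is arbitrary, but [t |-> G (max t 0)] is monotone. *)
have -> : (fun t : R => G `|t|) =
    (fun t : R => G (Num.max t 0)) \o (fun t : R => `|t|).
  by apply/funext => t /=; rewrite max_l.
apply: measurableT_comp; last exact: normr_measurable.
apply: nondecreasing_measurable => // t u tu.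
apply: N_function_le; first by rewrite le_max lexx orbT.
by rewrite ge_max !le_max tu lexx orbT.
Qed.

End N_function_theory.

(** * Euclidean distance and volumes of balls *)

Section euclidean_distance.
Context {R : realType} {n : nat}.
Implicit Types x y z : n.-tuple R.

Lemma edist_ge0 x y : 0 <= edist x y.
Proof. exact: sqrtr_ge0. Qed.

Lemma edistC x y : edist x y = edist y x.
Proof.
by rewrite /edist; congr Num.sqrt; apply: eq_bigr => i _; rewrite -sqrrN opprB.
Qed.

Lemma sqr_edist x y : edist x y ^+ 2 = \sum_(i < n) (tnth x i - tnth y i) ^+ 2.
Proof. by rewrite sqr_sqrtr// sumr_ge0// => i _; rewrite sqr_ge0. Qed.

Lemma edist_eq0 x y : edist x y = 0 -> x = y.
Proof.
move=> d0; have := sqr_edist x y; rewrite d0 expr0n/= => /esym/eqP.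
rewrite psumr_eq0; last by move=> i _; rewrite sqr_ge0.
move=> /allP h; apply: eq_from_tnth => i.
by have := h i (mem_index_enum i); rewrite sqrf_eq0 subr_eq0 => /eqP.
Qed.

Lemma Cauchy_Schwarz_sum (a b : 'I_n -> R) :
  (\sum_i a i * b i) ^+ 2 <= (\sum_i a i ^+ 2) * (\sum_i b i ^+ 2).
Proof.
rewrite -subr_ge0 -(pmulrn_lge0 _ (isT : (0 < 2)%N)).
suff -> : ((\sum_i a i ^+ 2) * (\sum_i b i ^+ 2) - (\sum_i a i * b i) ^+ 2) *+ 2
    = \sum_i \sum_j (a i * b j - a j * b i) ^+ 2.
  by apply: sumr_ge0 => i _; apply: sumr_ge0 => j _; exact: sqr_ge0.
have E (f g : 'I_n -> R) :
  (\sum_i f i) * (\sum_i g i) = \sum_i \sum_j f i * g j.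
  by rewrite mulr_suml; apply: eq_bigr => i _; rewrite mulr_sumr.
transitivity ((\sum_i a i ^+ 2) * (\sum_i b i ^+ 2) +
    (\sum_i b i ^+ 2) * (\sum_i a i ^+ 2) -
    ((\sum_i a i * b i) * (\sum_i a i * b i)) *+ 2); first by ring.
rewrite !E -big_split/=.
rewrite -sumrMnl -sumrB; apply: eq_bigr => i _.
rewrite -big_split/= -sumrMnl -sumrB; apply: eq_bigr => j _; ring.
Qed.

Lemma edist_triangle x y z : edist x z <= edist x y + edist y z.
Proof.
rewrite -(@ler_pXn2r _ 2)// ?nnegrE ?addr_ge0 ?edist_ge0//.
rewrite sqrrD !sqr_edist.
set a := fun i => tnth x i - tnth y i; set b := fun i => tnth y i - tnth z i.
have -> : \sum_(i < n) (tnth x i - tnth z i) ^+ 2 =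
    \sum_i a i ^+ 2 + (\sum_i a i * b i) *+ 2 + \sum_i b i ^+ 2.
  rewrite -sumrMnl -!big_split/=; apply: eq_bigr => i _; rewrite /a /b; ring.
rewrite lerD2r lerD2l lerMn2r//=.
apply: (le_trans (ler_norm _)).
rewrite -(@ler_pXn2r _ 2)// ?nnegrE ?mulr_ge0 ?edist_ge0//.
by rewrite exprMn !sqr_edist real_normK ?num_real// Cauchy_Schwarz_sum.
Qed.

Lemma tnth_le_edist x y i : `|tnth x i - tnth y i| <= edist x y.
Proof.
rewrite -sqrtr_sqr ler_wsqrtr// (bigD1 i)//= lerDl sumr_ge0// => j _.
exact: sqr_ge0.
Qed.

(** A cube of half-side [a] lies in the open ball of radius [n * a], because
    [sqrt n < n] for [n > 1]; measuring balls by inscribed and circumscribed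
    cubes avoids computing their volume. *)
Lemma edist_lt_cube x y (a : R) : 0 < a -> (1 < n)%N ->
  (forall i, `|tnth x i - tnth y i| <= a) -> edist x y < n%:R * a.
Proof.
move=> a0 n1 h; have na : 0 < n%:R * a by rewrite mulr_gt0// ltr0n ltnW.
rewrite -(@ltr_pXn2r _ 2)// ?nnegrE ?edist_ge0 ?(ltW na)//.
rewrite sqr_edist; apply: (@le_lt_trans _ _ (\sum_(i < n) a ^+ 2)).
  apply: ler_sum => i _; rewrite -[X in X <= _]real_normK ?num_real//.
  by rewrite ler_pXn2r// nnegrE// ltW.
rewrite sumr_const card_ord -[X in X < _]mulr_natl exprMn ltr_pM2r ?exprn_gt0//.
by rewrite -natrX ltr_nat -[ltnLHS]muln1 ltn_pmul2l// ltnW.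
Qed.

End euclidean_distance.

Section balls.
Context {R : realType} {n : nat}.
Implicit Types x y z : n.-tuple R.
Local Notation leb := (@lebesgue_tuple R n).

Lemma measurable_edist :
  measurable_fun setT (fun w : n.-tuple R * n.-tuple R => edist w.1 w.2).
Proof.
have -> : (fun w : n.-tuple R * n.-tuple R => edist w.1 w.2) =
  (fun w => (\sum_(i < n) (tnth w.1 i - tnth w.2 i) ^+ 2) `^ 2^-1).
  by apply/funext => w; rewrite powR12_sqrt// sumr_ge0// => i _; rewrite sqr_ge0.
apply: (@measurableT_comp _ _ _ _ _ _ (@powR R ^~ 2^-1)) => //.
apply: measurable_sum => i; apply: (@measurable_funX _ _ _ _
  (fun w : n.-tuple R * n.-tuple R => tnth w.1 i - tnth w.2 i)).
apply: measurable_funB;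
    apply: (@measurableT_comp _ _ _ _ _ _ (fun t : n.-tuple R => tnth t i)).
- exact: measurable_tnth.
- exact: measurable_fst.
- exact: measurable_tnth.
- exact: measurable_snd.
Qed.

Lemma measurable_edistl x : measurable_fun setT (edist x).
Proof. exact: (measurableT_comp measurable_edist (pair1_measurable x)). Qed.

Lemma measurable_eball x (r : R) : measurable (eball x r).
Proof.
rewrite [eball _ _](_ : _ = setT `&` edist x @^-1` `]-oo, r[%classic).
  exact: measurable_edistl.
by rewrite setTI; apply/seteqP; split => y; rewrite /= in_itv.
Qed.

Definition cube x (a : R) : set (n.-tuple R) :=
  [set y | forall i, `]tnth x i - a, tnth x i + a[%classic (tnth y i)].

Lemma cubeP x (a : R) y : cube x a y <-> forall i, `|tnth x i - tnth y i| < a.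
Proof. by split => h i; have := h i; rewrite /= in_itv/= -ltr_distlC. Qed.

Lemma measurable_cube x (a : R) : measurable (cube x a).
Proof.
have -> : cube x a = \bigcap_(i in [set: 'I_n])
    ((@tnth n R)^~ i @^-1` `]tnth x i - a, tnth x i + a[%classic).
  by apply/seteqP; split => y /= h i; [move=> _|]; exact: h.
apply: fin_bigcap_measurable => // i _.
by rewrite -[X in measurable X]setTI; exact: measurable_tnth.
Qed.

Lemma lebesgue_cube x (a : R) : 0 < a -> leb (cube x a) = ((2 * a) ^+ n)%:E.
Proof.
move=> a0.
rewrite (@lebesgue_tuple_box R n
  (fun i => `]tnth x i - a, tnth x i + a[%classic))//.
rewrite (eq_bigr (fun=> (2 * a)%:E)).
  by rewrite prodEFin prodr_const card_ord.
move=> i _; rewrite lebesgue_measure_itv/= lte_fin ifT; last lra.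
by rewrite -EFinB; congr _%:E; ring.
Qed.

Lemma eball_le x (r : R) : 0 < r -> (leb (eball x r) <= ((2 * r) ^+ n)%:E)%E.
Proof.
move=> r0; rewrite -(lebesgue_cube x r0); apply: le_measure; rewrite ?inE.
- exact: measurable_eball.
- exact: measurable_cube.
- by move=> y xy; apply/cubeP => i; exact: le_lt_trans (tnth_le_edist x y i) xy.
Qed.

Lemma eball_ge x (r : R) : (1 < n)%N -> 0 < r ->
  (((2 * (r / n%:R)) ^+ n)%:E <= leb (eball x r))%E.
Proof.
move=> n1 r0; have n0 : 0 < n%:R :> R by rewrite ltr0n ltnW.
have a0 : 0 < r / n%:R by rewrite divr_gt0.
rewrite -(lebesgue_cube x a0); apply: le_measure; rewrite ?inE.
- exact: measurable_cube.
- exact: measurable_eball.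
- move=> y /cubeP xy.
  rewrite /eball/= [ltRHS](_ : r = n%:R * (r / n%:R)).
    by apply: edist_lt_cube => // i; exact/ltW.
  by rewrite mulrCA divff ?mulr1 ?gt_eqF.
Qed.

(** Interior corkscrew condition for a ball: moving from [x] towards the centre by
    the fraction [t = rho / (2 r)] of the way gains a distance [rho / 2] from the
    boundary, at a distance less than [rho / 2] from [x]. *)
Lemma eball_inner_ball x0 x (r rho : R) : 0 < rho -> rho <= 2 * r ->
  eball x0 r x -> exists z, eball z (rho / 2) `<=` eball x0 r `&` eball x rho.
Proof.
move=> rho0 rhor xr; have {}xr : edist x0 x < r := xr.
have r0 : 0 < r by lra.
pose t := rho / (2 * r).
have t0 : 0 < t by rewrite divr_gt0// mulr_gt0.
have t1 : t <= 1 by rewrite ler_pdivrMr ?mul1r// mulr_gt0.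
have tr : t * r = rho / 2 by rewrite /t; field; exact: lt0r_neq0.
pose z : n.-tuple R := [tuple tnth x i + t * (tnth x0 i - tnth x i) | i < n].
have zx : edist x z = t * edist x0 x.
  rewrite /edist -[t in RHS]gtr0_norm// -sqrtr_sqr -sqrtrM ?sqr_ge0//.
  congr Num.sqrt; rewrite mulr_sumr; apply: eq_bigr => i _.
  by rewrite tnth_mktuple -exprMn -sqrrN; congr (_ ^+ 2); ring.
have zx0 : edist x0 z = (1 - t) * edist x0 x.
  have t1' : 0 <= 1 - t by lra.
  rewrite /edist -[1 - t in RHS]ger0_norm// -sqrtr_sqr -sqrtrM ?sqr_ge0//.
  congr Num.sqrt; rewrite mulr_sumr; apply: eq_bigr => i _.
  by rewrite tnth_mktuple -exprMn; congr (_ ^+ 2); ring.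
exists z => y zy; have {}zy : edist z y < rho / 2 := zy.
rewrite /eball; split => /=.
  apply: (le_lt_trans (edist_triangle x0 z y)); rewrite zx0.
  have : (1 - t) * edist x0 x <= (1 - t) * r by rewrite ler_wpM2l ?subr_ge0// ltW.
  by lra.
apply: (le_lt_trans (edist_triangle x z y)); rewrite zx.
have : t * edist x0 x < t * r by rewrite ltr_pM2l.
by lra.
Qed.

End balls.

(** * Null sets and Borel representatives *)

Section null_modification.
Context d (T : measurableType d) (R : realType).
Variable mu : {measure set T -> \bar R}.
Local Open Scope ereal_scope.
Import HBNNSimple.

(** The integral of a nonnegative function is the supremum of the integrals of the
    simple functions below it, and multiplying such a simple function by the
    indicator of the complement of [N] does not change its integral.  The
    statement is about arbitrary functions because it is applied to integrands
    that are measurable only for the completed sigma-algebra. *)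
Lemma ge0_le_integral_off_null (D N : set T) (f g : T -> \bar R) :
  measurable N -> mu N = 0 ->
  (forall x, D x -> 0 <= f x) -> (forall x, D x -> 0 <= g x) ->
  (forall x, D x -> ~ N x -> f x <= g x) ->
  \int[mu]_(x in D) f x <= \int[mu]_(x in D) g x.
Proof.
move=> mN N0 f0 g0 fg; rewrite !ge0_integralE//.
apply: ge_ereal_sup => _ [h /= hf <-].
pose h' := mul_nnsfun h (indic_nnsfun R (measurableC mN)).
have h'E x : h' x = (h x * \1_(~` N) x)%R by [].
apply: ereal_sup_ubound; exists h' => /=.
  move=> x; rewrite -[leLHS]/((h x * \1_(~` N) x)%:E) indicE.
  have [Nx|Nx] := pselect (N x).
    rewrite memNset ?mulr0; last by rewrite /setC/=; tauto.
    by rewrite patchE; case: ifPn => //; rewrite inE => /g0.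
  rewrite mem_set// mulr1; apply: (le_trans (hf x)).
  rewrite !patchE; case: ifPn => //; rewrite inE => Dx; exact: fg.
rewrite -!integralT_nnsfun.
have E (u : {nnsfun T >-> R}) :
    \int[mu]_x (u x)%:E = \int[mu]_(x in ~` N) (u x)%:E.
  rewrite (ge0_negligible_integral mN)// ?setTD//.
    exact/measurable_EFinP.
  by move=> x _; rewrite lee_fin.
rewrite !E; apply: eq_integral => x; rewrite inE => Nx.
by rewrite h'E indicE mem_set// mulr1.
Qed.

Lemma ge0_eq_integral_off_null (D N : set T) (f g : T -> \bar R) :
  measurable N -> mu N = 0 ->
  (forall x, D x -> 0 <= f x) -> (forall x, D x -> 0 <= g x) ->
  (forall x, D x -> ~ N x -> f x = g x) ->
  \int[mu]_(x in D) f x = \int[mu]_(x in D) g x.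
Proof.
move=> mN N0 f0 g0 fg; apply/eqP; rewrite eq_le; apply/andP; split;
  by apply: (ge0_le_integral_off_null mN) => // x Dx Nx; rewrite fg.
Qed.

Lemma eq_integral_off_null (D N : set T) (f g : T -> \bar R) :
  measurable N -> mu N = 0 ->
  (forall x, D x -> ~ N x -> f x = g x) ->
  \int[mu]_(x in D) f x = \int[mu]_(x in D) g x.
Proof.
move=> mN N0 fg; rewrite integralE [RHS]integralE; congr (_ - _).
  by apply: (ge0_eq_integral_off_null mN) => // x Dx Nx; rewrite !funeposE fg.
by apply: (ge0_eq_integral_off_null mN) => // x Dx Nx; rewrite !funenegE fg.
Qed.

Lemma ge0_le_integral_set (D : set T) (f g : T -> \bar R) :
  (forall x, D x -> 0 <= f x) -> (forall x, D x -> f x <= g x) ->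
  \int[mu]_(x in D) f x <= \int[mu]_(x in D) g x.
Proof.
move=> f0 fg; apply: (@ge0_le_integral_off_null D set0) => //.
  by move=> x Dx; exact: le_trans (f0 _ Dx) (fg _ Dx).
by move=> x Dx _; exact: fg.
Qed.

End null_modification.

Section borel_representative.
Context d (T : measurableType d) (R : realType).
Variable mu : {measure set T -> \bar R}.

(** Each rational upper level set of [f] is a measurable set up to a null set.  Off
    the countable union [N] of these null sets all level sets of [f] become
    measurable, so that [f] extended by [0] from [U `\` N] is measurable. *)
Lemma measurable_fun_representative (U : set T) (f : T -> R) :
  measurable U ->
  (forall Y : set R, measurable Y ->
    completed_algebra_gen mu (U `&` f @^-1` Y)) ->
  exists2 g : T -> R, measurable_fun setT g &
  exists N, [/\ measurable N, mu N = 0%E & forall x, U x -> ~ N x -> f x = g x].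
Proof.
move=> mU mf.
have key (q : rat) : exists AN : set (T) * set (T),
    [/\ measurable AN.1, measurable AN.2, mu AN.2 = 0%E &
     U `&` f @^-1` `]ratr q, +oo[%classic `\` AN.2 = AN.1 `\` AN.2].
  have [A mA [N [N' [mN' N'0 NN']] <-]] :=
    mf `]ratr q, +oo[%classic (measurable_itv _).
  exists (A, N'); split => //=; apply/seteqP; split => x /=.
    by move=> [[Ax|Nx]] N'x; split => //; case: N'x; exact: NN'.
  by move=> [Ax N'x]; split => //; left.
have [AN hAN] := choice key.
pose F (k : nat) := if unpickle k is Some q then (AN q).2 else set0.
have mF k : measurable (F k).
  by rewrite /F; case: unpickle => // q; have [] := hAN q.
have F0 k : mu (F k) = 0%E.
  by rewrite /F; case: unpickle => [q|]; [have [] := hAN q|rewrite measure0].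
pose N := \bigcup_k F k.
have mN : measurable N by exact: bigcupT_measurable.
have N0 : mu N = 0%E.
  by apply/(negligibleP _ mN)/negligible_bigcup => k; exists (F k); split.
have subN q : (AN q).2 `<=` N.
  by move=> x Nx; exists (pickle q) => //; rewrite /F pickleK.
exists (f \_ (U `\` N)); last first.
  by exists N; split => // x Ux Nx; rewrite patchE mem_set.
apply/measurable_restrict => //; first exact: measurableD.
rewrite setTI.
apply: (measurability _ (RGenOInfty.measurableE R)) => //.
move=> /= _ [_ [a ->] <-].
have -> : (U `\` N) `&` f @^-1` `]a, +oo[%classic =
    \bigcup_(q in [set q : rat | a < ratr q]) ((AN q).1 `\` N).
  apply/seteqP; split => x /=.
    move=> [[Ux Nx]]; rewrite in_itv/= andbT => afx.
    have [q] := rat_in_itvoo afx; rewrite in_itv/= => /andP[aq qf].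
    exists q => //=; split => //.
    have [_ _ _ /seteqP[+ _]] := hAN q => /(_ x) [] //=.
    split; last by move/subN.
    by rewrite in_itv/= andbT.
  move=> [q /= aq [Ax Nx]].
  have [_ _ _ /seteqP[_ +]] := hAN q => /(_ x) [] /=.
    by split => // /subN.
  move=> [Ux +] _; rewrite !in_itv/= !andbT => qf; split => //.
  exact: lt_trans qf.
rewrite bigcup_mkcond; apply: bigcupT_measurable_rat => q; case: ifPn => // _.
by apply: measurableD => //; have [] := hAN q.
Qed.

End borel_representative.

(** * Oscillation of averages *)

Section mean_oscillation.
Context d (T : measurableType d) (R : realType).
Variable mu : {measure set T -> \bar R}.
Variable g : T -> R.
Local Notation average A := ((fine (mu A))^-1 * \int[mu]_(x in A) g x)%R.
Local Open Scope ereal_scope.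

Lemma dist_average_le (A : set T) (c : R) : measurable A -> mu A < +oo ->
  (0 < fine (mu A))%R -> mu.-integrable A (EFin \o g) ->
  (fine (mu A))%:E * `|c - average A|%:E <= \int[mu]_(y in A) `|c - g y|%:E.
Proof.
move=> mA Aoo A0 gint.
have cint : mu.-integrable A (EFin \o cst c).
  by apply: measurable_bounded_integrable => //; exact: bounded_cst.
have -> : (fine (mu A))%:E * `|c - average A|%:E =
    `|\int[mu]_(y in A) (c - g y)|%R%:E.
  rewrite -EFinM -[X in (X * _)%R](gtr0_norm A0) -normrM mulrBr mulrA.
  rewrite divff ?gt_eqF// mul1r (RintegralB mA cint gint) Rintegral_cst//.
  by rewrite mulrC.
have dint : mu.-integrable A (EFin \o (fun y => c - g y)%R).
  by rewrite [X in integrable _ _ X](_ : _ = (EFin \o cst c) \- (EFin \o g))//;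
    exact: integrableB.
rewrite EFin_normr_Rintegral//.
apply: (le_trans (le_abse_integral _ _ _)) => //.
exact: measurable_int dint.
Qed.

(** [dist_average_le] is used twice: with the constant [average A] and the
    points of [A'], and then, for every [y] in [A], with the constant [g y]. *)
Lemma dist_averages_le (A A' : set T) : measurable A -> measurable A' ->
  A' `<=` A -> mu A < +oo -> (0 < fine (mu A'))%R ->
  mu.-integrable A (EFin \o g) ->
  (fine (mu A) * fine (mu A') * `|average A - average A'|)%:E <=
  \int[mu]_(y in A) \int[mu]_(z in A) `|g y - g z|%:E.
Proof.
move=> mA mA' A'A Aoo A'0 gint.
have muA'A : mu A' <= mu A by apply: le_measure; rewrite ?inE.
have A'oo : mu A' < +oo by exact: le_lt_trans Aoo.
have A0 : (0 < fine (mu A))%R.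
  by apply: (lt_le_trans A'0); rewrite fine_le// ge0_fin_numE.
have g'int : mu.-integrable A' (EFin \o g) by exact: integrableS gint.
have mg : measurable_fun A g by apply/measurable_EFinP; exact: measurable_int gint.
have mdist c : measurable_fun A (fun y => `|c - g y|%:E).
  apply/measurable_EFinP; apply: measurableT_comp => //.
  exact: measurable_funB.
apply: (@le_trans _ _ ((fine (mu A))%:E * \int[mu]_(y in A) `|average A - g y|%:E)).
  rewrite -mulrA EFinM; apply: lee_pmul => //;
    rewrite ?lee_fin ?mulr_ge0 // ?(ltW A0) ?(ltW A'0)//.
  rewrite EFinM.
  apply: (le_trans (dist_average_le (average A) mA' A'oo A'0 g'int)).
  exact: ge0_subset_integral.
rewrite -ge0_integralZl_EFin ?(ltW A0)//. 
apply: ge0_le_integral_set.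
  by move=> y _; rewrite -EFinM lee_fin mulr_ge0// ltW.
by move=> y _; rewrite distrC; exact: dist_average_le.
Qed.

End mean_oscillation.

(** * The Gagliardo kernel *)

Section gagliardo_kernel.
Context {R : realType} {n : nat}.
Implicit Types (x y : n.-tuple R) (g : n.-tuple R -> R).
Local Notation leb := (@lebesgue_tuple R n).

Definition gagliardo_kernel (s : R) (G : R -> R) g x y : R :=
  G (`|g x - g y| / edist x y `^ s) / edist x y ^+ n.

Variables (s : R) (G : R -> R) (g : n.-tuple R -> R).
Hypotheses (s0 : 0 <= s) (NG : N_function G).
Local Notation k := (gagliardo_kernel s G g).

Lemma gagliardo_kernel_ge0 x y : 0 <= k x y.
Proof.
apply: divr_ge0; last by rewrite exprn_ge0// edist_ge0.
by apply: (N_function_ge0 NG); rewrite divr_ge0// powR_ge0.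
Qed.

Lemma measurable_gagliardo_kernel : measurable_fun setT g ->
  measurable_fun setT (fun w : n.-tuple R * n.-tuple R => k w.1 w.2).
Proof.
move=> mg.
have minv (h : n.-tuple R * n.-tuple R -> R) : (forall w, 0 <= h w) ->
    measurable_fun setT h -> measurable_fun setT (fun w => (h w)^-1).
  move=> h0 mh; rewrite (_ : (fun w => (h w)^-1) = (@powR R ^~ (-1)) \o h).
    by apply: measurableT_comp.
  by apply/funext => w /=; rewrite powR_inv1.
have md := @measurable_edist R n.
apply: measurable_funM; last first.
  apply: minv => [w|]; first by rewrite exprn_ge0// edist_ge0.
  exact: measurable_funX.
rewrite (_ : (fun w : n.-tuple R * n.-tuple R =>
    G (`|g w.1 - g w.2| / edist w.1 w.2 `^ s)) = (fun t : R => G `|t|) \o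
    (fun w => `|g w.1 - g w.2| / edist w.1 w.2 `^ s)); last first.
  apply/funext => w /=; congr G.
  by rewrite [RHS]ger0_norm// divr_ge0// powR_ge0.
apply: measurableT_comp; first exact: measurable_N_function_norm.
apply: measurable_funM.
  apply: measurableT_comp => //; apply: measurable_funB.
    exact: (measurableT_comp mg measurable_fst).
  exact: (measurableT_comp mg measurable_snd).
apply: minv => [w|]; first exact: powR_ge0.
exact: (measurableT_comp (measurable_powR _) md).
Qed.

(** [N_function_young] for [u = |g x - g y| / |x - y| ^ s], where the powers of
    [|x - y|] are absorbed into those of [rho].  It also holds for [g x = g y],
    in particular on the diagonal, where [u] is not a difference quotient. *)
Lemma N_function_young_kernel (m rho : R) x y : 0 <= m -> edist x y <= rho ->
  G m * `|g x - g y| <= m * rho `^ s * (rho ^+ n * k x y + G m).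
Proof.
move=> m0 xyr; have rho0 : 0 <= rho by exact: le_trans (edist_ge0 x y) xyr.
have Gm := N_function_ge0 NG m0.
have [->|gxy] := eqVneq (g x) (g y).
  rewrite subrr normr0 mulr0 !mulr_ge0 ?powR_ge0//.
  by rewrite addr_ge0// mulr_ge0 ?gagliardo_kernel_ge0// exprn_ge0.
have d0 : 0 < edist x y.
  rewrite lt_neqAle edist_ge0 andbT eq_sym; apply/negP => /eqP /edist_eq0 xy.
  by rewrite xy eqxx in gxy.
have ds0 : 0 < edist x y `^ s by rewrite powR_gt0.
set u := `|g x - g y| / edist x y `^ s.
have u0 : 0 <= u by rewrite divr_ge0// ltW.
have -> : `|g x - g y| = edist x y `^ s * u.
  by rewrite /u mulrC divfK// gt_eqF.
have dn0 : 0 < edist x y ^+ n by rewrite exprn_gt0.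
have Gu : G u <= rho ^+ n * k x y.
  rewrite /gagliardo_kernel -/u mulrA ler_pdivlMr// mulrC ler_wpM2r//.
    exact: N_function_ge0.
  by rewrite lerXn2r// nnegrE// ltW.
rewrite mulrCA.
apply: (le_trans (ler_wpM2l (ltW ds0) (N_function_young NG m0 u0))).
rewrite mulrCA -mulrA; apply: ler_wpM2l => //; apply: ler_pM.
- exact: ltW.
- by rewrite addr_ge0// N_function_ge0.
- by rewrite ge0_ler_powR// nnegrE// ltW.
- by rewrite lerD2r.
Qed.

Lemma integral_dist_le_kernel (m rho : R) x (A : set (n.-tuple R)) :
  measurable_fun setT g -> measurable A -> 0 <= m ->
  (forall y, A y -> edist x y <= rho) -> 0 <= rho ->
  ((G m)%:E * \int[leb]_(y in A) `|g x - g y|%:E <=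
   (m * rho `^ s)%:E * ((rho ^+ n)%:E * \int[leb]_(y in A) (k x y)%:E
                        + (G m)%:E * leb A))%E.
Proof.
move=> mg mA m0 Ar rho0; have Gm := N_function_ge0 NG m0.
have mk : measurable_fun A (fun y => (k x y)%:E).
  apply/measurable_EFinP; apply: measurable_funTS.
  exact: (measurableT_comp (measurable_gagliardo_kernel mg) (pair1_measurable x)).
have mgx : measurable_fun A (fun y => `|g x - g y|%:E).
  apply/measurable_EFinP; apply: measurable_funTS.
  by apply: measurableT_comp => //; exact: measurable_funB.
have k0 y : (0 <= (k x y)%:E)%E by rewrite lee_fin gagliardo_kernel_ge0.
have c0 : 0 <= rho ^+ n by rewrite exprn_ge0.
rewrite -ge0_integralZl_EFin// -integral_cst// -ge0_integralZl_EFin//.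
rewrite -ge0_integralD//; first last.
- exact: measurable_funeM.
- by move=> y _; rewrite mule_ge0// lee_fin.
rewrite -ge0_integralZl_EFin//; first last.
- by rewrite mulr_ge0// powR_ge0.
- apply: emeasurable_funD => //; exact: measurable_funeM.
- by move=> y _; rewrite adde_ge0// mule_ge0// lee_fin.
apply: ge0_le_integral_set => y Ay; first by rewrite mule_ge0// lee_fin.
by rewrite /= -!EFinM lee_fin; apply: N_function_young_kernel => //; exact: Ar.
Qed.

End gagliardo_kernel.

(** * The chain of shrinking sets *)

Section chain.
Context {R : realType} {n : nat}.
Implicit Types (x y : n.-tuple R).
Local Notation leb := (@lebesgue_tuple R n).
Hypothesis n1 : (1 < n)%N.

(** The first radius is the diameter of the ball, so that the chain starts at the
    whole ball whatever its centre [x]. *)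
Definition chain_radius (r : R) (i : nat) : R := 2 * r / 2 ^+ i.

Definition chain_set x0 (r : R) x i : set (n.-tuple R) :=
  eball x0 r `&` eball x (chain_radius r i).

Variables (x0 : n.-tuple R) (r : R).
Hypothesis r0 : 0 < r.
Local Notation B := (eball x0 r).
Local Notation rho := (chain_radius r).
Local Notation A := (chain_set x0 r).

Lemma chain_radius_gt0 i : 0 < rho i.
Proof. by rewrite divr_gt0 ?mulr_gt0// exprn_gt0. Qed.

Lemma chain_radiusS i : rho i.+1 = rho i / 2.
Proof. by rewrite /chain_radius exprSr invfM mulrA. Qed.

Lemma chain_radius_le i : rho i <= 2 * r.
Proof.
have h2 : 1 <= 2 ^+ i :> R by rewrite exprn_ege1// ler1n.
have r2 : 0 <= 2 * r by rewrite mulr_ge0// ltW.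
by rewrite ler_pdivrMr ?exprn_gt0// ler_peMr.
Qed.

Lemma measurable_chain_set x i : measurable (A x i).
Proof. by apply: measurableI; exact: measurable_eball. Qed.

Lemma chain_set_sub x i : A x i `<=` B.
Proof. exact: subIsetl. Qed.

Lemma chain_setS x i : A x i.+1 `<=` A x i.
Proof.
apply: setIS => y; rewrite /eball/= => /lt_le_trans; apply.
by have := chain_radius_gt0 i; rewrite chain_radiusS; lra.
Qed.

Lemma chain_set0 x : B x -> A x 0 = B.
Proof.
move=> Bx; apply/setIidPl => y By.
have {}Bx : edist x0 x < r := Bx; have {}By : edist x0 y < r := By.
rewrite /eball/= /chain_radius expr0 divr1.
by apply: (le_lt_trans (edist_triangle x x0 y)); rewrite edistC; lra.
Qed.

Lemma chain_set_edist x i y : A x i y -> edist x y < rho i.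
Proof. by case. Qed.

Lemma chain_set_edist2 x i y z : A x i y -> A x i z -> edist y z <= 2 * rho i.
Proof.
move=> /chain_set_edist xy /chain_set_edist xz.
by apply: (le_trans (edist_triangle y x z)); rewrite edistC; lra.
Qed.

Lemma chain_set_lty x i : (leb (A x i) < +oo)%E.
Proof.
apply: (@le_lt_trans _ _ (leb (eball x (rho i)))).
  by apply: le_measure; rewrite ?inE;
    [exact: measurable_chain_set|exact: measurable_eball|exact: subIsetr].
by apply: (le_lt_trans (eball_le _ (chain_radius_gt0 i))); rewrite ltry.
Qed.

Lemma chain_set_fin x i : leb (A x i) = (fine (leb (A x i)))%:E.
Proof. by rewrite fineK// ge0_fin_numE// chain_set_lty. Qed.

Lemma chain_set_le x i : fine (leb (A x i)) <= (2 * rho i) ^+ n.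
Proof.
rewrite -lee_fin -chain_set_fin.
apply: (@le_trans _ _ (leb (eball x (rho i)))).
  by apply: le_measure; rewrite ?inE;
    [exact: measurable_chain_set|exact: measurable_eball|exact: subIsetr].
exact: (eball_le _ (chain_radius_gt0 i)).
Qed.

Lemma chain_set_ge x i : B x -> (rho i / n%:R) ^+ n <= fine (leb (A x i)).
Proof.
move=> Bx; rewrite -lee_fin -chain_set_fin.
have [z hz] := eball_inner_ball (chain_radius_gt0 i) (chain_radius_le i) Bx.
have rho2 : 0 < rho i / 2 by rewrite divr_gt0// chain_radius_gt0.
apply: (@le_trans _ _ (leb (eball z (rho i / 2)))).
  apply: le_trans (eball_ge z n1 rho2).
  rewrite lee_fin [X in _ <= X ^+ n](_ : _ = rho i / n%:R)//.
  by field; rewrite pnatr_eq0 -lt0n ltnW.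
by apply: le_measure; rewrite ?inE//;
  [exact: measurable_eball|exact: measurable_chain_set].
Qed.

Lemma chain_set_gt0 x i : B x -> 0 < fine (leb (A x i)).
Proof.
move=> Bx; apply: lt_le_trans (chain_set_ge i Bx).
by rewrite exprn_gt0// divr_gt0 ?chain_radius_gt0// ltr0n ltnW.
Qed.

End chain.

(** * The energy estimate for one step of the chain *)

Section sections.
Context d1 d2 (T1 : measurableType d1) (T2 : measurableType d2) (R : realType).
Variable mu : {sigma_finite_measure set T2 -> \bar R}.

Lemma measurable_fun_integral_section (D : set T2) (f : T1 * T2 -> \bar R) :
  measurable D -> measurable_fun setT f -> (forall w, (0 <= f w)%E) ->
  measurable_fun setT (fun x => (\int[mu]_(y in D) f (x, y))%E).
Proof.
move=> mD mf f0; pose F := f \_ (setT `*` D).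
have mF : measurable_fun setT F.
  apply/measurable_restrict => //; first exact: measurableX.
  exact: measurable_funS mf.
have F0 w : (0 <= F w)%E by rewrite /F patchE; case: ifP.
rewrite (_ : (fun x => _) = fubini_F mu F).
  exact: measurable_fun_fubini_tonelli_F.
apply/funext => x; rewrite /fubini_F [LHS]integral_mkcond.
apply: eq_integral => y _.
rewrite /F !patchE; congr (if _ then _ else _).
by apply/idP/idP; rewrite !inE/= => h; [split|case: h].
Qed.

End sections.

Section chain_step.
Context {R : realType} {n : nat}.
Implicit Types (x y : n.-tuple R).
Local Notation leb := (@lebesgue_tuple R n).
Hypothesis n1 : (1 < n)%N.
Variables (s : R) (G : R -> R) (g : n.-tuple R -> R) (x0 : n.-tuple R) (r : R).
Hypotheses (s0 : 0 < s) (NG : N_function G) (r0 : 0 < r).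
Hypothesis mg : measurable_fun setT g.
Local Notation B := (eball x0 r).
Local Notation rho := (chain_radius r).
Local Notation A := (chain_set x0 r).
Hypothesis gint : leb.-integrable B (EFin \o g).

Definition kernel_integral x : \bar R :=
  \int[leb]_(y in B) (gagliardo_kernel s G g x y)%:E.
Local Notation H := kernel_integral.
Hypothesis Eoo : (\int[leb]_(x in B) H x < +oo)%E.

Lemma kernel_integral_ge0 x : (0 <= H x)%E.
Proof. by apply: integral_ge0 => y _; rewrite lee_fin gagliardo_kernel_ge0. Qed.

Lemma measurable_kernel_integral : measurable_fun setT H.
Proof.
apply: (@measurable_fun_integral_section _ _ _ _ _ leb B
  (fun w => (gagliardo_kernel s G g w.1 w.2)%:E)).
- exact: measurable_eball.
- by apply/measurable_EFinP; exact: measurable_gagliardo_kernel.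
- by move=> w; rewrite lee_fin gagliardo_kernel_ge0.
Qed.

Lemma chain_kernel_le x y i :
  (\int[leb]_(z in A x i) (gagliardo_kernel s G g y z)%:E <= H y)%E.
Proof.
apply: ge0_subset_integral.
- exact: measurable_chain_set.
- exact: measurable_eball.
- apply/measurable_EFinP; apply: measurable_funTS.
  exact: (measurableT_comp (measurable_gagliardo_kernel s NG mg)
    (pair1_measurable y)).
- by move=> z _; rewrite lee_fin gagliardo_kernel_ge0.
- exact: chain_set_sub.
Qed.

Lemma chain_integrable x i : leb.-integrable (A x i) (EFin \o g).
Proof.
apply: integrableS gint.
- exact: measurable_eball.
- exact: measurable_chain_set.
- exact: chain_set_sub.
Qed.

Definition chain_energy x i : R := fine (\int[leb]_(y in A x i) H y).

Lemma chain_energy_fin x i :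
  (\int[leb]_(y in A x i) H y = (chain_energy x i)%:E)%E.
Proof.
rewrite /chain_energy fineK// ge0_fin_numE; last first.
  by apply: integral_ge0 => y _; exact: kernel_integral_ge0.
apply: le_lt_trans Eoo; apply: ge0_subset_integral.
- exact: measurable_chain_set.
- exact: measurable_eball.
- exact: measurable_funTS measurable_kernel_integral.
- by move=> z _; exact: kernel_integral_ge0.
- exact: chain_set_sub.
Qed.

Lemma chain_energy_ge0 x i : 0 <= chain_energy x i.
Proof.
by apply: fine_ge0; apply: integral_ge0 => y _; exact: kernel_integral_ge0.
Qed.

(** Integrate [N_function_young_kernel] over [A_i * A_i]: the inner integral of the
    kernel is at most [H y], as [A_i] is contained in the ball. *)
Lemma chain_step_measure_le (m : R) x i : 0 <= m -> B x ->
  G m * (fine (leb (A x i)) * fine (leb (A x i.+1)) *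
         `|mean (A x i) g - mean (A x i.+1) g|) <=
  m * (2 * rho i) `^ s * ((2 * rho i) ^+ n * chain_energy x i +
                          G m * fine (leb (A x i)) ^+ 2).
Proof.
move=> m0 Bx; set a := fine (leb (A x i)); set b := fine (leb (A x i.+1)).
have Gm := N_function_ge0 NG m0.
have rhoi := chain_radius_gt0 r0 i.
have rho2 : 0 <= 2 * rho i by rewrite mulr_ge0// ltW.
have mA := measurable_chain_set x0 r x i.
have Aa : leb (A x i) = a%:E by exact: chain_set_fin.
have a0 : 0 <= a by rewrite /a fine_ge0.
rewrite -lee_fin EFinM.
have /(lee_wpmul2l (_ : (0 <= (G m)%:E)%E)) := @dist_averages_le _ _ _ leb g _ _
  mA (measurable_chain_set x0 r x i.+1) (chain_setS r0 (i := i))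
  (chain_set_lty x0 r0 x i) (chain_set_gt0 n1 r0 (i.+1) Bx) (chain_integrable x i).
rewrite lee_fin => /(_ Gm) /le_trans; apply.
have mh y : measurable_fun (A x i) (fun z => `|g y - g z|%:E).
  apply/measurable_EFinP; apply: measurable_funTS.
  by apply: measurableT_comp => //; exact: measurable_funB.
rewrite -ge0_integralZl_EFin//; last 2 first.
- by move=> y _; apply: integral_ge0.
- apply: measurable_funTS.
  apply: (@measurable_fun_integral_section _ _ _ _ _ leb _
    (fun w => `|g w.1 - g w.2|%:E)) => //.
  apply/measurable_EFinP; apply: measurableT_comp => //; apply: measurable_funB.
    exact: (measurableT_comp mg measurable_fst).
  exact: (measurableT_comp mg measurable_snd).
pose c := m * (2 * rho i) `^ s.
have c0 : 0 <= c by rewrite mulr_ge0// powR_ge0.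
have mHA : measurable_fun (A x i) H.
  exact: measurable_funTS measurable_kernel_integral.
apply: (@le_trans _ _ (\int[leb]_(y in A x i)
    (c%:E * (((2 * rho i) ^+ n)%:E * H y + (G m * a)%:E)))%E).
  apply: ge0_le_integral_set => y Ay.
    by rewrite mule_ge0// integral_ge0.
  apply: (le_trans (integral_dist_le_kernel (ltW s0) NG mg mA m0 _ rho2)).
    by move=> z Az; exact: chain_set_edist2 Ay Az.
  apply: lee_wpmul2l; first by rewrite lee_fin.
  rewrite Aa -EFinM; apply: leeD => //; apply: lee_wpmul2l.
    by rewrite lee_fin exprn_ge0.
  exact: chain_kernel_le.
rewrite ge0_integralZl_EFin//; last 2 first.
- move=> y _; apply: adde_ge0; last by rewrite lee_fin mulr_ge0.
  by apply: mule_ge0; [rewrite lee_fin exprn_ge0|exact: kernel_integral_ge0].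
- by apply: emeasurable_funD => //; exact: measurable_funeM.
rewrite ge0_integralD//; last 3 first.
- move=> y _; apply: mule_ge0; last exact: kernel_integral_ge0.
  by rewrite lee_fin exprn_ge0.
- exact: measurable_funeM.
- by move=> y _; rewrite lee_fin mulr_ge0.
rewrite ge0_integralZl_EFin ?exprn_ge0//; last first.
  by move=> y _; exact: kernel_integral_ge0.
have -> : (\int[leb]_(y in A x i) (G m * a)%:E = (G m * a ^+ 2)%:E)%E.
  by rewrite integral_cst// [X in (_ * X)%E]Aa -EFinM expr2 mulrA.
by rewrite chain_energy_fin -!EFinM lee_fin.
Qed.

(** The constant [(4 n ^ 2) ^ n] is the ratio of [(2 rho_i) ^ n * rho_i ^ n] to the
    product [(rho_i / n) ^ n * (rho_i / (2 n)) ^ n] of the lower bounds of the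
    measures of [A_i] and [A_(i+1)]. *)
Lemma chain_step_le (m : R) x i : 0 <= m -> B x ->
  `|mean (A x i) g - mean (A x i.+1) g| * G m <=
  (4 * n%:R ^+ 2) ^+ n * m * (2 * rho i) `^ s *
    (chain_energy x i / rho i ^+ n + G m).
Proof.
move=> m0 Bx; have := chain_step_measure_le i m0 Bx.
set X := `|_|; set a := fine (leb (A x i)); set b := fine (leb (A x i.+1)).
set h := chain_energy x i; set C := (4 * n%:R ^+ 2) ^+ n.
move=> step.
have Gm := N_function_ge0 NG m0; have h0 : 0 <= h := chain_energy_ge0 x i.
have rhoi := chain_radius_gt0 r0 i.
have n0 : 0 < n%:R :> R by rewrite ltr0n ltnW.
have n1' : 1 <= n%:R :> R by rewrite ler1n ltnW.
have a0 : 0 < a by exact: chain_set_gt0.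
have b0 : 0 < b by exact: chain_set_gt0.
have aV : a <= (2 * rho i) ^+ n by exact: chain_set_le.
have av : (rho i / n%:R) ^+ n <= a by exact: chain_set_ge.
have bv : (rho i / 2 / n%:R) ^+ n <= b.
  by rewrite -chain_radiusS; exact: chain_set_ge.
have C0 : 0 <= C by rewrite exprn_ge0// mulr_ge0// exprn_ge0// ltW.
have E1 : a <= C * b.
  apply: (le_trans aV); apply: (le_trans _ (ler_wpM2l C0 bv)).
  rewrite [leRHS](_ : _ = (2 * rho i * n%:R) ^+ n); last first.
    by rewrite /C -exprMn; congr (_ ^+ n); field; rewrite gt_eqF.
  have rho2 : 0 <= 2 * rho i by rewrite mulr_ge0// ltW.
  have rho2n : 0 <= 2 * rho i * n%:R by rewrite mulr_ge0.
  by apply: lerXn2r; rewrite ?nnegrE// ler_peMr.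
have E2 : (2 * rho i) ^+ n * rho i ^+ n <= C * (a * b).
  have v0 : 0 <= (rho i / n%:R) ^+ n by rewrite exprn_ge0// divr_ge0// ltW.
  have w0 : 0 <= (rho i / 2 / n%:R) ^+ n 
    by apply: exprn_ge0; rewrite divr_ge0// divr_ge0// ltW.
  apply: (@le_trans _ _ (C * ((rho i / n%:R) ^+ n * (rho i / 2 / n%:R) ^+ n))).
    rewrite /C -!exprMn le_eqVlt; apply/orP; left; apply/eqP; congr (_ ^+ n).
    by field; rewrite gt_eqF.
  by apply: ler_wpM2l => //; exact: ler_pM.
have ab0 : 0 < a * b by rewrite mulr_gt0.
have rn0 : 0 < rho i ^+ n by rewrite exprn_gt0.
rewrite -(ler_pM2l ab0).
apply: (@le_trans _ _ (G m * (a * b * X))).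
  by rewrite le_eqVlt; apply/orP; left; apply/eqP; ring.
apply: (le_trans step).
set ms := (2 * rho i) `^ s.
have ms0 : 0 <= m * ms by rewrite mulr_ge0// powR_ge0.
rewrite [leRHS](_ : _ = m * ms *
  (C * (a * b) * (h / rho i ^+ n) + G m * (C * b * a))); last by ring.
apply: ler_wpM2l => //; apply: lerD.
  rewrite mulrA ler_pdivlMr// mulrAC; exact: ler_wpM2r.
by apply: ler_wpM2l => //; rewrite expr2; apply: ler_wpM2r => //; exact: ltW.
Qed.

End chain_step.

(** * Pointwise control by a single scale *)

Section pigeonhole.
Context {R : realType}.

(** If every step were smaller, the sequence would stay within half of the distance
    [|t - a 0|] of [a 0], since [(1 - q) * q ^ i] sums to [1]. *)
Lemma geometric_pigeonhole (a : R^nat) (t q : R) : 0 < q < 1 ->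
  a @ \oo --> t -> t != a 0%N ->
  exists i, (1 - q) / 2 * q ^+ i * `|t - a 0%N| <= `|a i - a i.+1|.
Proof.
move=> /andP[q0 q1] at_ ta; apply: contrapT => /forallNP no.
set T := `|t - a 0%N| in no.
have T0 : 0 < T by rewrite normr_gt0 subr_eq0.
have small k : `|a 0%N - a k| <= T / 2 * (1 - q ^+ k).
  elim: k => [|k IH]; first by rewrite expr0 !subrr normr0 mulr0.
  have /negP := no k; rewrite -ltNge => /ltW step.
  apply: (le_trans (ler_distD (a k) _ _)); apply: (le_trans (lerD IH step)).
  by rewrite exprS le_eqVlt; apply/orP; left; apply/eqP; field.
have T20 : 0 < T / 2 by rewrite divr_gt0.
move/cvgrPdist_lt : at_ => /(_ _ T20) [k _ /(_ k (leqnn k)) /= tk].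
have : T <= `|t - a k| + `|a k - a 0%N| by exact: ler_distD.
have := small k; rewrite distrC.
have : 0 <= T / 2 * q ^+ k by rewrite mulr_ge0 ?exprn_ge0// ltW.
by rewrite mulrBr mulr1; lra.
Qed.

End pigeonhole.

Section chain_ratio.
Context {R : realType}.

(** The unit of geometric decay: [rho_i ^ s] decays like [chain_ratio s ^ (4 i)];
    half of this decay is spent on the pigeonhole, a quarter on the exponent
    [theta], and one quarter is left to sum the series over the scales. *)
Definition chain_ratio (s : R) : R := 2 `^ (- (s / 4)).

Lemma chain_ratio_gt0 (s : R) : 0 < chain_ratio s.
Proof. by rewrite powR_gt0. Qed.

Lemma chain_ratio_lt1 (s : R) : 0 < s -> chain_ratio s < 1.
Proof.
move=> s0; rewrite /chain_ratio powRN invf_lt1 ?powR_gt0//.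
have s4 : 0 < s / 4 by rewrite divr_gt0.
rewrite lt_neqAle; apply/andP; split.
  rewrite eq_sym powR_eq1 !negb_or; apply/and3P; split.
  - by rewrite gt_eqF// ltr1n.
  - by rewrite -leNgt.
  - by rewrite gt_eqF.
rewrite [leLHS](_ : 1 = 1 `^ (s / 4)); last by rewrite powR1.
by apply: ge0_ler_powR; rewrite ?nnegrE ?(ltW s4) ?ler1n.
Qed.

Lemma chain_radius_powR (s r : R) i : 0 < r ->
  chain_radius r i `^ s = (2 * r) `^ s * (chain_ratio s ^+ 4) ^+ i.
Proof.
move=> r0; rewrite /chain_radius powRM; last 2 first.
- by rewrite mulr_ge0// ltW.
- by rewrite invr_ge0 exprn_ge0.
congr (_ * _).
have -> : chain_ratio s ^+ 4 = 2 `^ (- s).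
  rewrite /chain_ratio -powR_mulrn ?powR_ge0// -powRrM; congr (_ `^ _).
  by field.
rewrite -powR_mulrn ?powR_ge0// -powRrM -powR_inv1 ?exprn_ge0//.
rewrite -powR_mulrn// -!powRrM; congr (_ `^ _); ring.
Qed.

End chain_ratio.

Section pointwise_estimate.
Context {R : realType} {n : nat}.
Implicit Types (x y : n.-tuple R).
Local Notation leb := (@lebesgue_tuple R n).
Hypothesis n1 : (1 < n)%N.
Variables (s : R) (G : R -> R) (g : n.-tuple R -> R) (x0 : n.-tuple R) (r : R).
Hypotheses (s0 : 0 < s) (NG : N_function G) (r0 : 0 < r).
Hypothesis mg : measurable_fun setT g.
Local Notation B := (eball x0 r).
Local Notation rho := (chain_radius r).
Local Notation A := (chain_set x0 r).
Hypothesis gint : leb.-integrable B (EFin \o g).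
Local Notation H := (kernel_integral s G g x0 r).
Hypothesis Eoo : (\int[leb]_(x in B) H x < +oo)%E.
Local Notation p := (chain_ratio s).

(** Every point [x] with [H x] finite is a Lebesgue point of [g] along the chain:
    the kernel estimate bounds [|g x - a_i| * G m] by a multiple of [rho_i ^ s]. *)
Lemma chain_average_cvg x : B x -> (H x < +oo)%E ->
  (fun i => mean (A x i) g) @ \oo --> g x.
Proof.
move=> Bx Hoo; have [m m0 Gm] := N_function_pos NG.
set h := fine (H x).
have Hh : H x = h%:E.
  by rewrite /h fineK// ge0_fin_numE//; exact: kernel_integral_ge0.
have h0 : 0 <= h by rewrite /h fine_ge0//; exact: kernel_integral_ge0.
pose L := m * (n%:R ^+ n * h + G m) / G m.
have n0 : 0 < n%:R :> R by rewrite ltr0n ltnW.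
have bound i : `|g x - mean (A x i) g| <= L * (2 * r) `^ s * (p ^+ 4) ^+ i.
  rewrite -mulrA -chain_radius_powR//.
  set a := fine (leb (A x i)).
  have a0 : 0 < a by exact: chain_set_gt0.
  have rhoi := chain_radius_gt0 r0 i.
  have av : rho i ^+ n <= n%:R ^+ n * a.
    have : (rho i / n%:R) ^+ n <= a by exact: chain_set_ge.
    by rewrite expr_div_n ler_pdivrMr ?exprn_gt0// mulrC.
  have mA := measurable_chain_set x0 r x i.
  have near : G m * (a * `|g x - mean (A x i) g|) <=
      m * rho i `^ s * (rho i ^+ n * h + G m * a).
    rewrite -lee_fin EFinM.
    have /(lee_wpmul2l (_ : (0 <= (G m)%:E)%E)) := @dist_average_le _ _ _ leb g
      _ (g x) mA (chain_set_lty x0 r0 x i) a0 (chain_integrable gint x i).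
    rewrite lee_fin => /(_ (ltW Gm)) /le_trans; apply.
    apply: (le_trans (integral_dist_le_kernel (rho := rho i) (ltW s0) NG mg mA
      (ltW m0) _ (ltW rhoi))).
      by move=> y Ay; apply/ltW; exact: chain_set_edist Ay.
    rewrite [leRHS]EFinM; apply: lee_wpmul2l.
      by rewrite lee_fin mulr_ge0 ?powR_ge0// ltW.
    rewrite EFinD !EFinM; apply: leeD; last by rewrite -chain_set_fin.
    apply: lee_wpmul2l; first by rewrite lee_fin exprn_ge0// ltW.
    by rewrite -Hh; exact: chain_kernel_le.
  have Gma : 0 < G m * a by rewrite mulr_gt0.
  rewrite -(ler_pM2l Gma) -mulrA; apply: (le_trans near).
  rewrite [leRHS](_ : _ = m * rho i `^ s * (n%:R ^+ n * a * h + G m * a));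
    last first.
    by rewrite /L; field; rewrite gt_eqF.
  apply: ler_wpM2l; first by rewrite mulr_ge0 ?powR_ge0// ltW.
  by rewrite lerD2r; exact: ler_wpM2r.
have p1 : `|p ^+ 4| < 1.
  rewrite ger0_norm ?exprn_ge0 ?ltW ?chain_ratio_gt0//.
  by rewrite exprn_ilt1// ?chain_ratio_lt1// ltW// chain_ratio_gt0.
have := cvg_geometric (L * (2 * r) `^ s) p1.
move=> /cvgrPdist_le geo; apply/cvgrPdist_le => e /geo.
apply: filterS => i; rewrite sub0r normrN => gi.
exact: le_trans (bound i) (le_trans (ler_norm _) gi).
Qed.

Definition chain_cst : R :=
  4 * 4 `^ s * (4 * n%:R ^+ 2) ^+ n / (1 - p ^+ 2).

Lemma chain_ratio2 : 0 < p ^+ 2 < 1.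
Proof.
rewrite exprn_gt0 ?chain_ratio_gt0//= exprn_ilt1// ?chain_ratio_lt1//.
exact/ltW/chain_ratio_gt0.
Qed.

Lemma chain_cst_gt0 : 0 < chain_cst.
Proof.
have /andP[q0 q1] := chain_ratio2.
have n0 : 0 < n%:R :> R by rewrite ltr0n ltnW.
apply: divr_gt0; last by rewrite subr_gt0.
apply: mulr_gt0; first by rewrite mulr_gt0 ?powR_gt0//.
by rewrite exprn_gt0 ?mulr_gt0 ?exprn_gt0.
Qed.

(** For the scale [i] found by the pigeonhole take [m = T / (K * q ^ i)] in
    [chain_step_le], where [K = chain_cst] is such that the term [G m] on the right
    absorbs half of the left-hand side; this leaves [G m <= M_i].  The factor
    [q ^ i] then comes from [G (q ^ i * m) <= q ^ i * G m]. *)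
Lemma pointwise_chain_bound x : B x -> (H x < +oo)%E ->
  exists i, G (`|g x - mean B g| / r `^ s / chain_cst) <=
    (p ^+ 2) ^+ i * (chain_energy s G g x0 r x i / rho i ^+ n).
Proof.
move=> Bx Hoo; set q := p ^+ 2; have /andP[q0 q1] := chain_ratio2.
rewrite -/q in q0 q1.
have K0 := chain_cst_gt0; set K := chain_cst in K0 *.
have rs0 : 0 < r `^ s by rewrite powR_gt0.
have M0 i : 0 <= chain_energy s G g x0 r x i / rho i ^+ n.
  apply: divr_ge0; first exact: chain_energy_ge0.
  by rewrite exprn_ge0// ltW// chain_radius_gt0.
have A0 : mean (A x 0) g = mean B g by rewrite chain_set0.
have [gx|gx] := eqVneq (g x) (mean B g).
  exists 0%N; rewrite gx subrr normr0 !mul0r (N_function0 NG).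
  by rewrite mulr_ge0// exprn_ge0// ltW.
have [||i] := @geometric_pigeonhole _ (fun i => mean (A x i) g) (g x) q _
    (chain_average_cvg Bx Hoo); first by rewrite q0.
  by rewrite A0.
rewrite A0; set T := `|g x - mean B g| / r `^ s => step.
have T0 : 0 < T by rewrite divr_gt0// normr_gt0 subr_eq0.
exists i; set M := chain_energy _ _ _ _ _ _ _ / _.
pose m := T / (K * q ^+ i).
have qi0 : 0 < q ^+ i by rewrite exprn_gt0.
have m0 : 0 < m by rewrite divr_gt0// mulr_gt0.
have GmM : G m <= M.
  have := chain_step_le n1 s0 NG r0 mg gint Eoo i (ltW m0) Bx.
  rewrite -/M; set X := `|_|; set C := (4 * _) ^+ n => cs.
  have rE : (2 * rho i) `^ s = 4 `^ s * r `^ s * (q ^+ i * q ^+ i).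
    rewrite powRM ?(ltW (chain_radius_gt0 r0 i))// chain_radius_powR// mulrA.
    rewrite -powRM ?mulr_ge0 ?(ltW r0)// mulrA -powRM ?(ltW r0)//.
    by congr (_ `^ _ * _); [ring|rewrite -exprMn /q; congr (_ ^+ i); ring].
  (* The step estimate reads [X * G m <= Y * (M + G m)], while [2 * Y <= X]. *)
  pose Y := C * m * (4 `^ s * r `^ s * (q ^+ i * q ^+ i)).
  have n0 : 0 < n%:R :> R by rewrite ltr0n ltnW.
  have Y0 : 0 < Y.
    have C0 : 0 < C by rewrite exprn_gt0 ?mulr_gt0 ?exprn_gt0.
    have sr0 : 0 < 4 `^ s * r `^ s by rewrite mulr_gt0 ?powR_gt0.
    apply: mulr_gt0; first exact: mulr_gt0 C0 m0.
    exact: mulr_gt0 sr0 (mulr_gt0 qi0 qi0).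
  have YX : 2 * Y <= X.
    apply: le_trans step; rewrite le_eqVlt; apply/orP; left; apply/eqP.
    have -> : `|g x - mean B g| = m * (K * q ^+ i) * r `^ s.
      rewrite /m divfK ?gt_eqF//; last exact: mulr_gt0.
      by rewrite /T divfK// gt_eqF.
    rewrite /Y /K /chain_cst -/q -/C; field.
    by rewrite subr_eq0 gt_eqF.
  rewrite rE -/Y in cs.
  have Gm := N_function_ge0 NG (ltW m0).
  have := le_trans (ler_wpM2r Gm YX) cs.
  rewrite -mulrA mulrCA ler_pM2l//; lra.
rewrite [X in G X](_ : _ = q ^+ i * m); last first.
  by rewrite /m; field; rewrite !gt_eqF.
apply: (le_trans (N_function_scale NG _ (ltW m0))).
  by rewrite ltW//= exprn_ile1 ?ltW.
by apply: ler_wpM2l => //; exact: ltW.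
Qed.

End pointwise_estimate.

(** * Summation over the scales *)

Section tonelli_restrict.
Context d1 d2 (T1 : measurableType d1) (T2 : measurableType d2) (R : realType).
Variables (m1 : {sigma_finite_measure set T1 -> \bar R}).
Variables (m2 : {sigma_finite_measure set T2 -> \bar R}).

Lemma fubini_tonelli_restrict (D : set T1) (E : set T2) (f : T1 * T2 -> \bar R) :
  measurable D -> measurable E -> measurable_fun setT f ->
  (forall w, (0 <= f w)%E) ->
  (\int[m1]_(x in D) \int[m2]_(y in E) f (x, y) =
   \int[m2]_(y in E) \int[m1]_(x in D) f (x, y))%E.
Proof.
move=> mD mE mf f0; pose F := f \_ (D `*` E).
have mF : measurable_fun setT F.
  apply/measurable_restrict => //; first exact: measurableX.
  exact: measurable_funS mf.
have F0 w : (0 <= F w)%E by rewrite /F patchE; case: ifP.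
have memX x y : ((x, y) \in D `*` E) = (x \in D) && (y \in E).
  by apply/idP/andP; rewrite !inE => -[].
rewrite [LHS]integral_mkcond [RHS]integral_mkcond.
transitivity (\int[m1]_x \int[m2]_y F (x, y))%E.
  apply: eq_integral => x _; rewrite patchE; case: ifPn => xD.
    rewrite integral_mkcond; apply: eq_integral => y _.
    by rewrite /F !patchE memX xD.
  by rewrite integral0_eq// => y _; rewrite /F patchE memX (negbTE xD).
rewrite fubini_tonelli//; apply: eq_integral => y _; rewrite patchE.
case: ifPn => yE.
  rewrite [RHS]integral_mkcond; apply: eq_integral => x _.
  by rewrite /F !patchE memX yE andbT.
by rewrite integral0_eq// => x _; rewrite /F patchE memX (negbTE yE) andbF.
Qed.

End tonelli_restrict.

Section geometric_nneseries.
Context {R : realType}.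

Lemma nneseries_geometric_le (b p : R) (u : (\bar R)^nat) :
  0 <= b -> 0 < p < 1 ->
  (forall i, 0 <= u i)%E -> (forall i, u i <= (b * p ^+ i)%:E)%E ->
  (\sum_(0 <= i <oo) u i <= (b / (1 - p))%:E)%E.
Proof.
move=> b0 /andP[p0 p1] u0 ub; apply: lime_le.
  by apply: is_cvg_nneseries => i _ _.
apply: nearW => k; apply: (@le_trans _ _ (\sum_(0 <= i < k) (b * p ^+ i)%:E)%E).
  by apply: lee_sum => i _.
rewrite sumEFin lee_fin -mulr_sumr; apply: ler_wpM2l => //.
rewrite -[leRHS]mul1r ler_pdivlMr ?subr_gt0// big_mkord.
have := subrX1 p k; rewrite mulrC => e.
have : 0 <= p ^+ k by rewrite exprn_ge0// ltW.
by rewrite -[1 - p]opprB mulrN -e; lra.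
Qed.

End geometric_nneseries.

Section borel_sobolev_poincare.
Context {R : realType} {n : nat}.
Implicit Types (x y : n.-tuple R).
Local Notation leb := (@lebesgue_tuple R n).
Hypothesis n1 : (1 < n)%N.
Variables (s : R) (G : R -> R) (g : n.-tuple R -> R) (x0 : n.-tuple R) (r : R).
Hypotheses (s0 : 0 < s) (NG : N_function G) (r0 : 0 < r).
Hypothesis mg : measurable_fun setT g.
Local Notation B := (eball x0 r).
Local Notation rho := (chain_radius r).
Local Notation A := (chain_set x0 r).
Hypothesis gint : leb.-integrable B (EFin \o g).
Local Notation H := (kernel_integral s G g x0 r).
Hypothesis Eoo : (\int[leb]_(x in B) H x < +oo)%E.
Local Notation p := (chain_ratio s).
Local Notation ce := (chain_energy s G g x0 r).
Let E0 := fine (\int[leb]_(x in B) H x).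

Let H0 x : (0 <= H x)%E := kernel_integral_ge0 s g x0 r NG x.

Let EE0 : (\int[leb]_(x in B) H x = E0%:E)%E.
Proof. by rewrite /E0 fineK// ge0_fin_numE// integral_ge0. Qed.

Let E00 : 0 <= E0. Proof. by rewrite /E0 fine_ge0// integral_ge0. Qed.

(** The integrand of the energy on [A_i(x)] as a function of the pair [(x, y)], to
    which Tonelli's theorem applies. *)
Let chain_section i (w : n.-tuple R * n.-tuple R) : \bar R :=
  ((H \o snd) \_ [set w | edist w.1 w.2 < rho i]) w.

Let chain_section_ge0 i w : (0 <= chain_section i w)%E.
Proof. by rewrite /chain_section patchE; case: ifP => // _; exact: H0. Qed.

Let measurable_chain_section i : measurable_fun setT (chain_section i).
Proof.
apply/measurable_restrict => //.
  rewrite [X in measurable X](_ : _ = setT `&`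
    (fun w : n.-tuple R * n.-tuple R => edist w.1 w.2)
      @^-1` `]-oo, rho i[%classic).
    exact: measurable_edist.
  by rewrite setTI; apply/seteqP; split => w; rewrite /= in_itv.
apply: measurable_funTS; apply: measurableT_comp => //.
exact: measurable_kernel_integral.
Qed.

Let chain_energyE x i :
  (ce x i)%:E = (\int[leb]_(y in B) chain_section i (x, y))%E.
Proof.
rewrite -chain_energy_fin// /chain_set integral_mkcondr; apply: eq_integral => y _.
by rewrite /chain_section !patchE; congr (if _ then _ else _);
  apply/idP/idP; rewrite !inE.
Qed.

Let measurable_chain_energy i : measurable_fun setT (fun x => ce x i).
Proof.
apply/measurable_EFinP; rewrite (_ : _ \o _ =
    fun x => (\int[leb]_(y in B) chain_section i (x, y))%E).
  by apply: measurable_fun_integral_section => //; exact: measurable_eball.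
by apply/funext => x /=; rewrite chain_energyE.
Qed.

Let chain_energy_le x i : ce x i <= E0.
Proof.
rewrite -lee_fin -EE0 -chain_energy_fin//; apply: ge0_subset_integral.
- exact: measurable_chain_set.
- exact: measurable_eball.
- by apply: measurable_funTS; exact: measurable_kernel_integral.
- by move=> z _.
- exact: chain_set_sub.
Qed.

(** By Tonelli: each [y] belongs to [A_i(x)] for [x] in [A_i(y)] only, a set of
    measure at most [(2 rho_i) ^ n]. *)
Lemma integral_chain_energy_le i :
  (\int[leb]_(x in B) (ce x i)%:E <= ((2 * rho i) ^+ n * E0)%:E)%E.
Proof.
have rho2 : 0 <= (2 * rho i) ^+ n.
  by rewrite exprn_ge0// mulr_ge0// ltW// chain_radius_gt0.
under eq_integral do rewrite chain_energyE.
rewrite fubini_tonelli_restrict//; last 2 first.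
- exact: measurable_eball.
- exact: measurable_eball.
rewrite EFinM -EE0 -ge0_integralZl_EFin//; last 2 first.
- exact: measurable_eball.
- by apply: measurable_funTS; exact: measurable_kernel_integral.
apply: ge0_le_integral_set => y By; first by apply: integral_ge0.
have -> : (\int[leb]_(x in B) chain_section i (x, y) =
    \int[leb]_(x in A y i) cst (H y) x)%E.
  rewrite integral_mkcondr; apply: eq_integral => x _.
  rewrite /chain_section !patchE; congr (if _ then _ else _).
  by apply/idP/idP; rewrite !inE /eball/= edistC.
rewrite integral_cst; last exact: measurable_chain_set.
rewrite muleC; apply: lee_wpmul2r => //.
rewrite [leLHS](_ : _ = (fine (leb (A y i)))%:E); last exact: chain_set_fin.
by rewrite lee_fin; exact: chain_set_le.
Qed.

(** Any exponent below [1 + s / (2 n)] would do: the growth [2 ^ (i n (theta - 1))]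
    has to be beaten by [2 ^ (- i s / 2)]. *)
Definition sobolev_exponent : R := 1 + s / (4 * n%:R).
Local Notation theta := sobolev_exponent.

Let n0 : 0 < n%:R :> R. Proof. by rewrite ltr0n ltnW. Qed.

Lemma sobolev_exponent_gt1 : 1 < theta.
Proof. by rewrite /theta ltrDl divr_gt0// mulr_gt0. Qed.

Let theta0 : 0 <= theta.
Proof. exact/ltW/(lt_trans ltr01 sobolev_exponent_gt1). Qed.

Let theta1 : 0 <= theta - 1.
Proof. by rewrite subr_ge0 ltW// sobolev_exponent_gt1. Qed.

Let M x i : R := ce x i / rho i ^+ n.

Let M0 x i : 0 <= M x i.
Proof.
apply: divr_ge0; first exact: chain_energy_ge0.
by rewrite exprn_ge0// ltW// chain_radius_gt0.
Qed.

Let powR_radius i :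
  (E0 / rho i ^+ n) `^ (theta - 1) = (E0 / (2 * r) ^+ n) `^ (theta - 1) * (p ^- i).
Proof.
have r20 : 0 < 2 * r by rewrite mulr_gt0.
have -> : E0 / rho i ^+ n = E0 / (2 * r) ^+ n * 2 `^ (i * n)%:R.
  rewrite powR_mulrn// exprM /chain_radius expr_div_n; field.
  by rewrite !gt_eqF ?exprn_gt0.
rewrite powRM ?powR_ge0 ?divr_ge0 ?exprn_ge0 ?(ltW r20)//; congr (_ * _).
have -> : p ^+ i = 2 `^ (- (s / 4) * i%:R).
  by rewrite powRrM powR_mulrn ?powR_ge0.
rewrite -powRrM -powRN; congr (_ `^ _).
by rewrite /theta natrM; field; rewrite gt_eqF.
Qed.

(** In [M_i ^ theta = M_i * M_i ^ (theta - 1)] the second factor is bounded by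
    [(E0 / rho_i ^ n) ^ (theta - 1)], which grows like [p ^ - i] by the choice of
    [theta]; the factor [(p ^ 2) ^ i] compensates it with [p ^ i] to spare. *)
Lemma integral_power_chain_le (a : R) i : 0 <= a ->
  (\int[leb]_(x in B) ((a * ((p ^+ 2) ^+ i * M x i)) `^ theta)%:E <=
   (a `^ theta * 2 ^+ n * E0 * (E0 / (2 * r) ^+ n) `^ (theta - 1) * p ^+ i)%:E)%E.
Proof.
move=> a0; have p0 := chain_ratio_gt0 s; have p1 := chain_ratio_lt1 s0.
have rhoi := chain_radius_gt0 r0 i.
have rn0 : 0 < rho i ^+ n by rewrite exprn_gt0.
have qi0 : 0 <= (p ^+ 2) ^+ i by rewrite exprn_ge0// exprn_ge0// ltW.
have qi1 : (p ^+ 2) ^+ i <= 1 by rewrite exprn_ile1 ?exprn_ge0 ?exprn_ile1 ?ltW.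
pose D := a `^ theta * (p ^+ 2) ^+ i * (E0 / rho i ^+ n) `^ (theta - 1)
  / rho i ^+ n.
have D0 : 0 <= D.
  by rewrite divr_ge0 ?(ltW rn0)// mulr_ge0 ?powR_ge0// mulr_ge0 ?powR_ge0.
apply: (@le_trans _ _ (\int[leb]_(x in B) (D%:E * (ce x i)%:E))%E).
  apply: ge0_le_integral_set => x Bx; first by rewrite lee_fin powR_ge0.
  have qM0 : 0 <= (p ^+ 2) ^+ i * M x i by exact: mulr_ge0.
  rewrite -EFinM lee_fin (powRM _ a0 qM0) (powRM _ qi0 (M0 x i)).
  rewrite [leRHS](_ : _ = a `^ theta * ((p ^+ 2) ^+ i *
      (M x i * (E0 / rho i ^+ n) `^ (theta - 1)))); last by rewrite /D /M; ring.
  apply: ler_wpM2l; first exact: powR_ge0.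
  apply: ler_pM; rewrite ?powR_ge0//.
    apply: ge1r_powR; last exact/ltW/sobolev_exponent_gt1.
    by rewrite qi1 andbT !exprn_gt0.
  rewrite -mulr_powRB1//; last exact: lt_trans ltr01 sobolev_exponent_gt1.
  apply: ler_wpM2l => //; apply: ge0_ler_powR; rewrite ?nnegrE//.
    by rewrite divr_ge0// ltW.
  by rewrite ler_pM2r ?invr_gt0//; exact: chain_energy_le.
rewrite ge0_integralZl_EFin//; last 3 first.
- exact: measurable_eball.
- by move=> x _; rewrite lee_fin chain_energy_ge0.
- by apply/measurable_EFinP; exact: measurable_funTS (measurable_chain_energy i).
apply: (le_trans (lee_wpmul2l _ (integral_chain_energy_le i))).
  by rewrite lee_fin.
rewrite -EFinM lee_fin /D powR_radius le_eqVlt; apply/orP; left; apply/eqP.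
have -> : (p ^+ 2) ^+ i = p ^+ i * p ^+ i by rewrite -exprMn expr2.
rewrite [(2 * rho i) ^+ n]exprMn; set X := (E0 / (2 * r) ^+ n) `^ _.
set pi := p ^+ i; set ri := rho i ^+ n.
have pi0 : pi != 0 by rewrite gt_eqF ?exprn_gt0.
have ri0 : ri != 0 by rewrite gt_eqF.
by field; rewrite ?pi0 ?ri0.
Qed.

(** [J] doublings turn the argument of [pointwise_chain_bound] into the difference
    quotient itself; the points with [H x = +oo] form a null set because the
    energy is finite. *)
Lemma borel_sobolev_poincare (kappa : R) (J : nat) : 0 <= kappa -> Delta2 G kappa ->
  @chain_cst R n s <= 2 ^+ J ->
  (\int[leb]_(x in B) ((G (`|g x - mean B g| / r `^ s)) `^ theta)%:E <=
   ((kappa ^+ J) `^ theta * 2 ^+ n * E0 * (E0 / (2 * r) ^+ n) `^ (theta - 1)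
     / (1 - p))%:E)%E.
Proof.
move=> k0 D2 KJ; have p0 := chain_ratio_gt0 s; have p1 := chain_ratio_lt1 s0.
have kJ0 : 0 <= kappa ^+ J by rewrite exprn_ge0.
have K0 := @chain_cst_gt0 R n n1 s s0.
have rs0 : 0 < r `^ s by rewrite powR_gt0.
have Hint : leb.-integrable B H.
  apply/integrableP; split.
    - by apply: measurable_funTS; exact: measurable_kernel_integral.
  by under eq_integral do rewrite gee0_abs//.
have [N [mN N0 BN]] := integrable_ae (measurable_eball x0 r) Hint.
pose Phi i x := ((kappa ^+ J * ((p ^+ 2) ^+ i * M x i)) `^ theta)%:E : \bar R.
have Phi0 i x : (0 <= Phi i x)%E by rewrite lee_fin powR_ge0.
apply: (@le_trans _ _ (\int[leb]_(x in B) (\sum_(0 <= i <oo) Phi i x))%E).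
  apply: (ge0_le_integral_off_null mN N0) => x Bx.
  - by rewrite lee_fin powR_ge0.
  - exact: nneseries_ge0.
  move=> Nx; have Hx : (H x < +oo)%E.
    rewrite -ge0_fin_numE//; apply: contrapT => Hx; apply: Nx; apply: BN => /=.
    by move=> /(_ Bx).
  have [i hi] := pointwise_chain_bound n1 s0 NG r0 mg gint Eoo Bx Hx.
  apply: (@le_trans _ _ (Phi i x)); last first.
    apply: le_trans (nneseries_lim_ge i.+1 (fun j _ _ => Phi0 j x)).
    rewrite big_nat_recr//= leeDr// sume_ge0//.
  rewrite lee_fin; apply: ge0_ler_powR; rewrite ?nnegrE//.
  - by rewrite (N_function_ge0 NG)// divr_ge0// ltW.
  - have qi0 : 0 <= (p ^+ 2) ^+ i by rewrite exprn_ge0// exprn_ge0// ltW.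
    exact: mulr_ge0 kJ0 (mulr_ge0 qi0 (M0 x i)).
  set T := `|_| / _ in hi *.
  have T0 : 0 <= T by rewrite divr_ge0// ltW.
  have TK0 : 0 <= T / @chain_cst R n s by rewrite divr_ge0// ltW.
  apply: (@le_trans _ _ (G (2 ^+ J * (T / @chain_cst R n s)))).
    apply: (N_function_le NG T0).
    by rewrite mulrCA ler_peMr// ler_pdivlMr// mul1r.
  by apply: (le_trans (Delta2_expn J k0 D2 TK0)); exact: ler_wpM2l.
rewrite integral_nneseries//; last 2 first.
- exact: measurable_eball.
- move=> i; apply/measurable_EFinP; apply: measurable_funTS.
  apply: (measurableT_comp (measurable_powR _)).
  apply: measurable_funM => //; apply: measurable_funM => //.
  by apply: measurable_funM => //.
apply: nneseries_geometric_le.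
- by rewrite !mulr_ge0 ?powR_ge0// exprn_ge0.
- by rewrite p0.
- by move=> i; exact: integral_ge0.
- by move=> i; exact: integral_power_chain_le.
Qed.

End borel_sobolev_poincare.

(** * From Borel functions to the general case *)

Section transfer.
Context {R : realType} {n : nat}.
Local Notation leb := (@lebesgue_tuple R n).

(** [N_function_young] with a fixed [m] such that [G m > 0] dominates [|g|] by an
    affine function of [G |g|]. *)
Lemma N_function_integrable (G : R -> R) (g : n.-tuple R -> R)
    (U : set (n.-tuple R)) :
  N_function G -> measurable U -> (leb U < +oo)%E -> measurable_fun setT g ->
  (\int[leb]_(x in U) (G `|g x|)%:E < +oo)%E -> leb.-integrable U (EFin \o g).
Proof.
move=> NG mU Uoo mg Goo; have [m m0 Gm] := N_function_pos NG.
have mGg : measurable_fun U (fun x => G `|g x|).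
  apply: measurable_funTS.
  exact: (measurableT_comp (measurable_N_function_norm NG) mg).
have iG : leb.-integrable U (EFin \o (fun x => G `|g x|)).
  apply/integrableP; split; first exact/measurable_EFinP.
  under eq_integral => x _ do rewrite gee0_abs ?lee_fin ?(N_function_ge0 NG)//.
  exact: Goo.
have iC : leb.-integrable U (EFin \o cst (G m)).
  by apply: measurable_bounded_integrable => //; exact: bounded_cst.
apply: le_integrable (integrableZl mU (m / G m) (integrableD mU iG iC)) => //.
  by apply/measurable_EFinP; exact: measurable_funTS.
move=> x Ux /=; rewrite lee_fin; apply: le_trans (ler_norm _).
rewrite mulrAC ler_pdivlMr// mulrC; exact: N_function_young (ltW m0) (normr_ge0 _).
Qed.

Variables (N U : set (n.-tuple R)) (f g : n.-tuple R -> R).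
Hypotheses (mN : measurable N) (N0 : leb N = 0%E).
Hypothesis fg : forall x, U x -> ~ N x -> f x = g x.

Lemma mean_off_null : mean U f = mean U g.
Proof.
rewrite /mean /Rintegral; congr (_ * fine _).
by apply: (eq_integral_off_null mN N0) => x Ux Nx; rewrite fg.
Qed.

Lemma gagliardo_energy_off_null (s : R) (G : R -> R) : N_function G ->
  gagliardo_energy s G U f = gagliardo_energy s G U g.
Proof.
move=> NG; apply: (ge0_eq_integral_off_null mN N0) => x Ux.
- apply: integral_ge0 => y _; rewrite lee_fin.
  exact: (gagliardo_kernel_ge0 s f NG).
- apply: integral_ge0 => y _; rewrite lee_fin.
  exact: (gagliardo_kernel_ge0 s g NG).
move=> Nx; apply: (ge0_eq_integral_off_null mN N0) => y Uy.
- by rewrite lee_fin; exact: (gagliardo_kernel_ge0 s f NG).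
- by rewrite lee_fin; exact: (gagliardo_kernel_ge0 s g NG).
by move=> Ny; rewrite !fg.
Qed.

End transfer.

Lemma exists_expn2_ge {R : realType} (x : R) :
  0 <= x -> exists J : nat, x <= 2 ^+ J.
Proof.
move=> x0; exists (Num.bound x); apply: (le_trans (ltW (archi_boundP x0))).
by rewrite -natrX ler_nat ltnW// ltn_expl.
Qed.

Section normalization.
Context {R : realType}.

(** Used with the volume [V] of a ball and the volume [W] of the circumscribed
    cube.  The constant [S >= 1] is moved under the power [theta] so that taking
    the root leaves the constant [k * S]. *)
Lemma power_normalization (theta k S E V W : R) : 1 < theta -> 0 <= k -> 1 <= S ->
  0 <= E -> 0 < V -> V <= W ->
  V^-1 * (k `^ theta * S * E * (E / W) `^ (theta - 1)) <=
  (k * S * (E / V)) `^ theta.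
Proof.
move=> th1 k0 S1 E0 V0 VW; have W0 : 0 < W by exact: lt_le_trans VW.
have th0 : 0 < theta by exact: lt_trans th1.
have S0 : 0 <= S by exact: le_trans S1.
have EV0 : 0 <= E / V by rewrite divr_ge0// ltW.
have EW0 : 0 <= E / W by rewrite divr_ge0// ltW.
rewrite (powRM _ (mulr_ge0 k0 S0) EV0) (powRM _ k0 S0).
rewrite [leLHS](_ : _ = k `^ theta * S * (E / V * (E / W) `^ (theta - 1)));
  last by ring.
apply: ler_pM.
- by rewrite mulr_ge0 ?powR_ge0.
- exact: mulr_ge0 EV0 (powR_ge0 _ _).
- by apply: ler_wpM2l; rewrite ?powR_ge0 ?le1r_powR// ltW.
rewrite -[leRHS]mulr_powRB1//; apply: ler_wpM2l => //.
apply: ge0_ler_powR; rewrite ?nnegrE ?subr_ge0//; first exact: ltW.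
by apply: ler_wpM2l => //; rewrite lef_pV2.
Qed.

End normalization.

Theorem lemma4p1 (R : realType) (n : nat) (hn : (2 <= n)%N)
    (s : R) (hs0 : 0 < s) (hs1 : s < 1) :
  exists2 theta : R, 1 < theta &
    forall kappa l : R, 1 < kappa -> 1 < l ->
    exists2 c : R, 0 < c &
      forall G : R -> R, N_function G -> Delta2 G kappa -> Nabla2 G l ->
      forall (x0 : n.-tuple R) (r : R), 0 < r ->
      forall f : n.-tuple R -> R,
        fractional_orlicz_sobolev s G (eball x0 r) f ->
        (poweR (mean_integral (eball x0 r) (fun x =>
            ((G (`|f x - mean (eball x0 r) f| / r `^ s)) `^ theta)%:E))
          theta^-1
        <= c%:E * ((fine (lebesgue_tuple n (eball x0 r)))^-1%:E *
                   gagliardo_energy s G (eball x0 r) f))%E.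
Proof.
have th1 := @sobolev_exponent_gt1 R n hn s hs0.
exists (@sobolev_exponent R n s) => //; set theta := sobolev_exponent _ in th1 *.
have th0 : 0 < theta by exact: lt_trans th1.
move=> kappa l k1 _; have k0 : 0 < kappa by exact: lt_trans k1.
have [J KJ] := exists_expn2_ge (ltW (@chain_cst_gt0 R n hn s hs0)).
have p0 := chain_ratio_gt0 s; have p1 := chain_ratio_lt1 hs0.
set p := chain_ratio s in p0 p1.
pose S := 2 ^+ n / (1 - p).
have S1 : 1 <= S.
  rewrite /S ler_pdivlMr ?subr_gt0// mul1r; apply: (@le_trans _ _ 1).
    by rewrite gerBl ltW.
  by rewrite exprn_ege1// ler1n.
have S0 : 0 < S by exact: lt_le_trans S1.
exists (kappa ^+ J * S); first by rewrite mulr_gt0// exprn_gt0.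
move=> G NG D2 _ x0 r r0 f [mf fint foo].
have mB := measurable_eball x0 r.
have [g mg [N [mN N0 fg]]] := measurable_fun_representative mB mf.
rewrite (gagliardo_energy_off_null mN N0 fg s NG) in foo *.
rewrite (mean_off_null mN N0 fg) /mean_integral.
have Boo : (lebesgue_tuple n (eball x0 r) < +oo)%E.
  by apply: (le_lt_trans (eball_le x0 r0)); rewrite ltry.
have gint : (lebesgue_tuple n).-integrable (eball x0 r) (EFin \o g).
  apply: (N_function_integrable NG mB Boo mg).
  rewrite -(ge0_eq_integral_off_null mN N0 (f := fun x => (G `|f x|)%:E))//.
  - by move=> x _; rewrite lee_fin (N_function_ge0 NG).
  - by move=> x _; rewrite lee_fin (N_function_ge0 NG).
  - by move=> x Bx Nx; rewrite fg.
rewrite (ge0_eq_integral_off_null mN N0 (g := fun x =>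
  ((G (`|g x - mean (eball x0 r) g| / r `^ s)) `^ theta)%:E)); last 3 first.
- by move=> x _; rewrite lee_fin powR_ge0.
- by move=> x _; rewrite lee_fin powR_ge0.
- by move=> x Bx Nx; rewrite fg.
have := borel_sobolev_poincare hn hs0 NG r0 mg gint foo (ltW k0) D2 KJ.
rewrite -/theta -/p.
have -> : gagliardo_energy s G (eball x0 r) g =
    (\int[lebesgue_tuple n]_(x in eball x0 r) kernel_integral s G g x0 r x)%E by [].
set E := (\int[_]_(x in _) kernel_integral _ _ _ _ _ _)%E in foo *.
have E0 : (0 <= E)%E.
  by apply: integral_ge0 => x _; exact: kernel_integral_ge0.
have EE : E = (fine E)%:E by rewrite fineK// ge0_fin_numE.
set I := (\int[_]_(x in _) _)%E; set V := fine (lebesgue_tuple n _) => IZ.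
have I0 : (0 <= I)%E by apply: integral_ge0 => x _; rewrite lee_fin powR_ge0.
have V0 : 0 < V.
  apply: (@lt_le_trans _ _ ((2 * (r / n%:R)) ^+ n)).
    by rewrite exprn_gt0// mulr_gt0// divr_gt0// ltr0n ltnW.
  by rewrite -lee_fin fineK ?ge0_fin_numE//; exact: eball_ge.
have VW : V <= (2 * r) ^+ n.
  by rewrite -lee_fin fineK ?ge0_fin_numE//; exact: eball_le.
have fE0 : 0 <= fine E by exact: fine_ge0.
have Vi0 : 0 <= V^-1 by rewrite invr_ge0 ltW.
pose X := kappa ^+ J * S * (fine E / V).
have X0 : 0 <= X.
  apply: mulr_ge0; last by rewrite divr_ge0// ltW.
  by rewrite mulr_ge0 ?exprn_ge0// ltW.
apply: (@le_trans _ _ (poweR (X `^ theta)%:E theta^-1)).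
  apply: gt0_ler_poweR.
  - by rewrite invr_ge0 ltW.
  - by rewrite in_itv/= leey andbT mule_ge0// lee_fin.
  - by rewrite in_itv/= leey andbT lee_fin powR_ge0.
  apply: (le_trans (lee_wpmul2l _ IZ)); first by rewrite lee_fin.
  have := power_normalization th1 (exprn_ge0 J (ltW k0)) S1 fE0 V0 VW.
  rewrite -EFinM lee_fin => /(le_trans _); apply.
  by rewrite le_eqVlt; apply/orP; left; apply/eqP; rewrite /S; ring.
rewrite poweR_EFin -powRrM divff ?gt_eqF// powRr1// [in leRHS]EE -!EFinM lee_fin.
by rewrite /X le_eqVlt; apply/orP; left; apply/eqP; ring.
Qed.
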